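(* Let $0<\varepsilon\le\alpha\le 1/8$ and $3\le\ell\le N$. There exists a constant $C>0$ such that if $$ n\ \le\ C\Big(\frac{8^{\ell}}{\alpha^{2\ell}}+\frac{\log(N/\ell)}{(6\alpha)^{\ell}}+\frac{\log N}{\varepsilon^2}\Big), $$ then the following holds: for any estimator $\hat K$ based on $n$ samples, there exists a kernel $K$ such that for all $1\le i<j\le N$ either $K_{i,j}=0$ or $|K_{i,j}|\ge\alpha$, such that the cycle sparsity of the graph $G_K$ induced by $K$ is $\ell$, and for which $\rho(\hat K,K)\ge\varepsilon$ with probability at least $1/3$.
   Context: $[N]=\{1,\dots,N\}$. A kernel is a symmetric matrix $K\in\mathbb{R}^{N\times N}$ with $0\preceq K\preceq I_N$. $\mathsf{DPP}(K)$ is the distribution of the random subset $Y\subseteq[N]$ with $\mathbb{P}[J\subseteq Y]=\det(K_J)$ for all $J\subseteq[N]$, where $K_J$ is the principal submatrix of $K$ indexed by $J$. The $n$ samples are independent copies $Y_1,\dots,Y_n$ of $Y\sim\mathsf{DPP}(K)$. The graph induced by $K$ is $G_K=([N],E)$, where distinct $i,j$ are joined by an edge if and only if $K_{i,j}\ne0$. $\mathcal{D}_N$ is the set of $N\times N$ diagonal matrices with only $1$ and $-1$ on the diagonal, and $\rho(K,K')=\inf_{D\in\mathcal{D}_N}|DKD-K'|_\infty$, where $|M|_\infty=\max_{i,j\in[N]}|M_{i,j}|$. For a graph $G=([N],E)$ with $|E|=m$, a cycle is a connected subgraph in which every vertex has even degree; its incidence vector in $GF(2)^m$ has entry $1$ at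 the edges of the cycle and $0$ elsewhere. The cycle space is the subspace of $GF(2)^m$ spanned by these incidence vectors. A simple cycle is one in which every vertex has degree two or zero and the vertices of degree two form a connected set. A cycle basis is a basis of the cycle space all of whose elements are simple cycles. The cycle sparsity of $G$ is the minimal $\ell$ for which $G$ admits a cycle basis of induced cycles of length at most $\ell$, with the convention $\ell=2$ if the cycle space is empty (trivial). *)

(* Defs.v *)
From HB Require Import structures.
From mathcomp Require Export all_boot all_order all_algebra.
From mathcomp Require Export all_classical all_reals all_analysis.

Set Implicit Arguments.
Unset Strict Implicit.
Unset Printing Implicit Defensive.

Import Order.TTheory GRing.Theory Num.Theory.

Local Open Scope ring_scope.

Section Graphs.
Variable T : finType.
Implicit Types (e : rel T) (F : {set {set T}}) (W : {set T}).

(* A simple graph is a symmetric irreflexive [e : rel T]; its edges are the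
   two-element sets [set i; j] with [e i j]. *)
Definition edges e : {set {set T}} :=
  [set E : {set T} | [exists i, exists j, e i j && (E == [set i; j])]].

(* A subgraph is represented by its edge set [F], with vertex set [finset.cover F]:
   isolated vertices do not affect incidence vectors. *)
Definition deg F (v : T) : nat := #|[set E in F | v \in E]|.

Definition connected_in F W : bool :=
  [forall u in W, forall v in W, connect (fun x y => [set x; y] \in F) u v].

Definition is_cycle e F : bool :=
  [&& F \subset edges e,
      connected_in F (finset.cover F)
    & [forall v, ~~ odd (deg F v)]].

Definition simple_cycle e F : bool :=
  [&& is_cycle e F,
      [forall v, (deg F v == 2%N) || (deg F v == 0%N)]
    & connected_in F [set v | deg F v == 2%N]].

Definition induced_cycle e F : bool :=
  is_cycle e F &&
  [forall i in finset.cover F, forall j in finset.cover F, e i j ==> ([set i; j] \in F)].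

Definition incidence e F : 'rV['F_2]_#|edges e| :=
  \row_k (enum_val k \in F)%:R.

Definition cycle_space e : {vspace 'rV['F_2]_#|edges e|} :=
  <<[seq incidence e F | F : {set {set T}} in is_cycle e]>>%VS.

Definition cycle_basis e (B : seq {set {set T}}) : bool :=
  all (simple_cycle e) B &&
  basis_of (cycle_space e) [seq incidence e F | F <- B].

(* The length of a cycle is its number of edges. *)
Definition has_induced_cycle_basis e (l : nat) : Prop :=
  exists2 B : seq {set {set T}}, cycle_basis e B &
    all (fun F => induced_cycle e F && (#|F| <= l)%N) B.

Definition has_cycle_sparsity e (l : nat) : Prop :=
  if cycle_space e == 0%VS then l = 2%N
  else has_induced_cycle_basis e l /\
       (forall k, has_induced_cycle_basis e k -> (l <= k)%N).

End Graphs.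

Section DPP.
Variables (R : realType) (N : nat).
Implicit Types (K M : 'M[R]_N) (p : {set 'I_N} -> R).

Definition psd M : Prop :=
  M^T = M /\ forall x : 'cV[R]_N, 0 <= (x^T *m M *m x) 0 0.

Definition is_kernel K : Prop := [/\ K^T = K, psd K & psd (1%:M - K)].

Definition principal_submx K (J : {set 'I_N}) : 'M[R]_#|J| :=
  mxsub enum_val enum_val K.

(* [p] is the probability mass function of DPP(K). *)
Definition is_dpp K p : Prop :=
  [/\ forall Y, 0 <= p Y,
      \sum_Y p Y = 1
    & forall J : {set 'I_N},
        \sum_(Y : {set 'I_N} | J \subset Y) p Y = \det (principal_submx K J)].

Definition induced_graph K : rel 'I_N :=
  fun i j => (i != j) && (K i j != 0).

Definition sign_diag : set 'M[R]_N :=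
  fun D => is_diag_mx D /\ forall i, D i i = 1 \/ D i i = -1.

(* [mx_norm] is the entrywise maximum norm. *)
Definition rho K K' : R :=
  inf [set mx_norm (D *m K *m D - K') | D in sign_diag]%classic.

(* Probability of the event [A] for [n] independent samples with mass
   function [p]. *)
Definition iid_prob p (n : nat) (A : pred (n.-tuple {set 'I_N})) : R :=
  \sum_(y | A y) \prod_(i < n) p (tnth y i).

End DPP.

(* Main.v *)
Require Import Defs.
From mathcomp Require Import all_boot all_order all_algebra.
From mathcomp Require Import all_classical all_reals all_analysis.
From mathcomp Require Import fingroup perm ring lra zify.

Set Implicit Arguments.
Unset Strict Implicit.
Unset Printing Implicit Defensive.

Import Order.TTheory GRing.Theory Num.Theory.
Local Open Scope ring_scope.

(** Split [N] into m = N / l consecutive blocks of length l (floor) and let the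
    base kernel be 1/2 on the diagonal, alpha on the edges of an l-cycle on
    every block, and 0 elsewhere.  Its graph is a disjoint union of l-cycles,
    hence of cycle sparsity l.  For every block b there is an alternative
    kernel, obtained by changing the base kernel inside b only, in one of two
    ways: reversing the sign of one edge, or adding 2 eps to one diagonal
    entry.  The sign of the product of the edge weights around a cycle is
    invariant under conjugation by a sign matrix, and so are the diagonal
    entries; so in both cases no matrix is eps-close, for [rho], to the base
    kernel and to an alternative ([flip_kernel_sep], [diag_kernel_sep]).

    The law of the n samples under the base kernel is then compared with the
    uniform mixture over b of the laws under the alternatives.  If an estimator
    succeeded with probability above 2/3 under every kernel of the family, some
    event would have probability below 1/3 under the first law and above 2/3
    under the second one, which forces their chi-square divergence above 1/3.
    The mass function of a DPP with a block diagonal kernel is a product over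
    the blocks, so the alternatives are pairwise orthogonal relative to the
    base law and only the m diagonal terms contribute: the divergence is at most
    ((1 + eta^2)^n - 1) / m, where eta bounds the relative change of the mass
    function ([mixture_le_cam]).  There is thus a hard kernel as soon as
    n eta^2 <= ln (1 + m / 3).

    It remains to bound eta.  The mass of Y is the determinant of the matrix
    with the rows of K on Y and those of 1 - K off Y; this matrix is
    diagonally dominant, so the block factors are at least 4^-l
    ([det_ge_prod_dominance]).  In the Leibniz formula, the permutations that
    see the sign of a single edge without squaring it follow the cycle in one
    of its two directions, so a sign reversal costs at most 4 alpha^l
    ([det_flip_cycle_edge]); a change of a diagonal entry by 2 eps costs at
    most 2 eps ([det_perturb_diag]).  Hence eta^2 is of order alpha^(2l) or
    eps^2, up to factors depending on l only.  Finally, since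
    (6 alpha)^l >= alpha^(2l) and ln N is at most a constant depending on l
    times ln (1 + m / 3), the three terms of the sample size are all covered
    by one of the two constructions: the first one if alpha^(2l) <= eps^2, the
    second one otherwise. *)

(** * Orbits of a permutation and their cycle graph *)

Section Orbits.
Variables (T : finType) (s : {perm T}).
Implicit Types x y : T.

Lemma mem_porbit_iter x k : iter k s x \in porbit s x.
Proof. by rewrite -permX mem_porbit. Qed.

Lemma porbit_iterP x y : y \in porbit s x -> exists k, y = iter k s x.
Proof. by move=> /porbitP [k ->]; exists k; rewrite permX. Qed.

Lemma mem_porbit_perm x y : (s y \in porbit s x) = (y \in porbit s x).
Proof. by rewrite -!eq_porbit_mem -[s y]/(iter 1 s y) -permX porbit_perm. Qed.

Lemma porbit_moved x y : y \in porbit s x -> (s y == y) = (s x == x).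
Proof.
move=> /porbit_iterP [k ->]; elim: k => //= k IH; rewrite -{}IH.
exact: (inj_eq perm_inj).
Qed.

Lemma moved_twice x : (2 < #|porbit s x|)%N -> s (s x) != x.
Proof.
have := uniq_traject_porbit s x; case: #|_| => [|[|[|n]]] //=.
by rewrite !inE !negb_or [x == s (s x)]eq_sym => /andP [/and3P []].
Qed.

(** Encoding cycles as the orbits of a permutation makes `next vertex' a
    function and lets sums and products around a cycle be reindexed. *)
Definition cycle_graph : rel T :=
  fun x y => (x != y) && ((y == s x) || (x == s y)).

End Orbits.

(** * Cycle sparsity of a disjoint union of cycles of equal length *)

Section CycleGraphSparsity.
Variables (T : finType) (s : {perm T}) (l : nat).
Hypothesis l_ge3 : (3 <= l)%N.
Hypothesis card_orbit : forall x, s x != x -> #|porbit s x| = l.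
Implicit Types (x y v : T) (E : {set T}) (F : {set {set T}}).

Let e := cycle_graph s.

Let s2_neq x : s x != x -> s (s x) != x.
Proof. by move=> sx; rewrite moved_twice // card_orbit. Qed.

Definition arc x : {set T} := [set x; s x].

Lemma arc_inj x y : s x != x -> arc x = arc y -> x = y.
Proof.
move=> sx xy; have : x \in arc y by rewrite -xy !inE eqxx.
rewrite !inE => /orP [/eqP //|/eqP xsy].
have : s x \in arc y by rewrite -xy !inE eqxx orbT.
rewrite !inE => /orP [/eqP sxy|/eqP /perm_inj //].
by have := s2_neq sx; rewrite sxy -xsy eqxx.
Qed.

Lemma mem_edges E : (E \in edges e) = [exists x, (s x != x) && (E == arc x)].
Proof.
rewrite inE; apply/existsP/existsP => [[x /existsP [y]]|[x /andP [sx /eqP ->]]].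
  rewrite /e /cycle_graph => /andP [/andP [xy /orP [/eqP h|/eqP h]] /eqP ->].
    by exists x; rewrite -h eq_sym xy /arc -h eqxx.
  by exists y; rewrite -h xy /arc -h finset.setUC eqxx.
by exists x; apply/existsP; exists (s x); rewrite /e /cycle_graph eq_sym sx !eqxx.
Qed.

Lemma arc_edge x : s x != x -> arc x \in edges e.
Proof. by move=> sx; rewrite mem_edges; apply/existsP; exists x; rewrite sx eqxx. Qed.

Lemma edgeP E : E \in edges e -> exists2 x, s x != x & E = arc x.
Proof. by rewrite mem_edges => /existsP [x /andP [sx /eqP ->]]; exists x. Qed.

(** The degree is taken at [s x] so that its two incident edges are the arcs
    leaving [s x] and [x], without inverting [s]. *)
Lemma deg_moved F x : F \subset edges e -> s x != x ->
  deg F (s x) = ((arc (s x) \in F) + (arc x \in F))%N.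
Proof.
move=> /fintype.subsetP Fe sx; rewrite /deg.
have ssx : s (s x) != s x by rewrite (inj_eq perm_inj).
have ne : arc x != arc (s x).
  by apply/eqP => /(arc_inj sx) /eqP; rewrite eq_sym (negPf sx).
rewrite (cardsD1 (arc (s x))) (cardsD1 (arc x)) !inE !eqxx orbT ne !andbT /=.
rewrite (_ : #|_| = 0)%N ?addn0 //.
apply/eqP; rewrite cards_eq0; apply/eqP/finset.setP => E.
rewrite !inE; apply/negP => /and4P [E1 E2 EF].
have [y sy Ey] := edgeP (Fe _ EF); rewrite Ey in E1 E2 *.
rewrite !inE => /orP [/eqP h|/eqP /perm_inj h]; first by rewrite h eqxx in E2.
by rewrite h eqxx in E1.
Qed.

Lemma deg_fixed F x : F \subset edges e -> s x = x -> deg F x = 0%N.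
Proof.
move=> /fintype.subsetP Fe sx; apply/eqP; rewrite cards_eq0; apply/eqP/finset.setP => E.
rewrite !inE; apply/negP => /andP [/Fe /edgeP [y sy ->]].
rewrite !inE => /orP [/eqP h|/eqP h]; first by rewrite -h sx eqxx in sy.
by move: sy; rewrite -[s y == y](inj_eq (@perm_inj _ s)) -h sx eqxx.
Qed.

(** Evenness at a vertex with two incident edges forces both or none of them
    into [F]; this propagates around the orbit.  Hence the even subgraphs are
    exactly the unions of full orbits. *)
Lemma cycle_constant_on_orbit F x y : is_cycle e F -> s x != x ->
  y \in porbit s x -> (arc y \in F) = (arc x \in F).
Proof.
move=> /and3P [Fe _ /forallP even] sx /porbit_iterP [k ->].
elim: k => //= k <-; set z := iter k s x.
have sz : s z != z by rewrite (porbit_moved (mem_porbit_iter s x k)).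
have := even (s z); rewrite deg_moved // oddD !oddb.
by case: (_ \in F); case: (_ \in F).
Qed.

Definition arcs (U : {set T}) := [set arc y | y in U].

Lemma mem_orbit_cycle x y : s y != y ->
  (arc y \in arcs (porbit s x)) = (y \in porbit s x).
Proof.
move=> sy; apply/finset.imsetP/idP => [[z zx /(arc_inj sy) -> //]|yx].
by exists y.
Qed.

Lemma orbit_cycle_sub x : s x != x -> arcs (porbit s x) \subset edges e.
Proof.
move=> sx; apply/fintype.subsetP => E /finset.imsetP [y yx ->].
by rewrite arc_edge // (porbit_moved yx).
Qed.

Lemma card_orbit_cycle x : s x != x -> #|arcs (porbit s x)| = l.
Proof.
move=> sx; rewrite card_in_imset ?card_orbit // => y z yx zx.
by apply: arc_inj; rewrite (porbit_moved yx).
Qed.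

Lemma cover_orbit_cycle x y : y \in finset.cover (arcs (porbit s x)) -> y \in porbit s x.
Proof.
move=> /bigcupP [E /finset.imsetP [z zx ->]].
by rewrite in_set2 => /orP [] /eqP -> //; rewrite mem_porbit_perm.
Qed.

Lemma connect_orbit x y z : y \in porbit s x -> z \in porbit s x ->
  connect (fun y z => [set y; z] \in arcs (porbit s x)) y z.
Proof.
move=> yx; have <- : porbit s y = porbit s x by apply/eqP; rewrite eq_porbit_mem.
move=> /porbit_iterP [k ->]; elim: k => [|k IH]; first exact: connect0.
apply: connect_trans IH _; apply: connect1; rewrite iterS.
apply/finset.imsetP; exists (iter k s y) => //.
exact: mem_porbit_iter.
Qed.

Lemma deg_orbit_cycle x y : s x != x ->
  deg (arcs (porbit s x)) y = if y \in porbit s x then 2%N else 0%N.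
Proof.
move=> sx; have sub := orbit_cycle_sub sx.
case: (eqVneq (s y) y) => [sy|sy].
  rewrite (deg_fixed sub sy); case: ifP => // yx.
  by have := porbit_moved yx; rewrite sy eqxx (negPf sx).
have sz : s ((s^-1)%g y) != (s^-1)%g y.
  by rewrite permKV; apply: contraNneq sy => h; rewrite {1}h permKV.
have := deg_moved sub sz; rewrite permKV => ->.
rewrite !mem_orbit_cycle // -[in X in (_ + X)%N](permKV s y).
rewrite -[in X in (_ + X)%N]mem_porbit_perm !permKV.
by case: (_ \in _).
Qed.

Lemma orbit_cycle_is_cycle x : s x != x -> is_cycle e (arcs (porbit s x)).
Proof.
move=> sx; apply/and3P; split; first exact: orbit_cycle_sub.
  apply/forall_inP => y /cover_orbit_cycle yx.
  by apply/forall_inP => z /cover_orbit_cycle zx; apply: connect_orbit.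
by apply/forallP => y; rewrite deg_orbit_cycle //; case: ifP.
Qed.

Lemma orbit_cycle_simple x : s x != x -> simple_cycle e (arcs (porbit s x)).
Proof.
move=> sx; apply/and3P; split; first exact: orbit_cycle_is_cycle.
  by apply/forallP => y; rewrite deg_orbit_cycle //; case: ifP.
have U y : deg (arcs (porbit s x)) y == 2%N -> y \in porbit s x.
  by rewrite deg_orbit_cycle //; case: ifP.
apply/forall_inP => y; rewrite inE => /U yx.
by apply/forall_inP => z; rewrite inE => /U zx; apply: connect_orbit.
Qed.

Lemma orbit_cycle_induced x : s x != x -> induced_cycle e (arcs (porbit s x)).
Proof.
move=> sx; rewrite /induced_cycle orbit_cycle_is_cycle //=.
apply/forall_inP => y /cover_orbit_cycle yx.
apply/forall_inP => z /cover_orbit_cycle zx; apply/implyP.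
rewrite /e /cycle_graph => /andP [_ /orP [] /eqP ->].
  by apply/finset.imsetP; exists y.
by apply/finset.imsetP; exists z => //; rewrite finset.setUC.
Qed.

Definition moved_orbits := [set porbit s x | x in [pred x | s x != x]].

Lemma moved_orbitP (U : {set T}) : U \in moved_orbits ->
  exists2 x, s x != x & U = porbit s x.
Proof. by move=> /finset.imsetP [x sx ->]; exists x. Qed.

(** The spanning half of the basis: an even subgraph is the disjoint union of
    the orbits it contains. *)
Lemma incidence_decomposition F : is_cycle e F ->
  incidence e F =
  \sum_(U in moved_orbits | arcs U \subset F) incidence e (arcs U).
Proof.
move=> cF; apply/rowP => k; rewrite summxE mxE.
have [y sy Ey] := edgeP (enum_valP k).
under eq_bigr => U _ do rewrite mxE Ey.
have yO : porbit s y \in moved_orbits by apply/finset.imsetP; exists y.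
have memO (U : {set T}) : U \in moved_orbits -> (arc y \in arcs U) = (U == porbit s y).
  move=> /moved_orbitP [x sx ->]; rewrite mem_orbit_cycle //.
  by rewrite eq_sym eq_porbit_mem.
have subF : (arcs (porbit s y) \subset F) = (arc y \in F).
  apply/fintype.subsetP/idP => [|yF E /finset.imsetP [z zy ->]].
    by apply; apply: imset_f; apply: porbit_id.
  by rewrite (cycle_constant_on_orbit cF sy zy).
rewrite Ey -subF; case: (boolP (arcs _ \subset F)) => h.
  rewrite (bigD1 (porbit s y)) ?yO //= memO // eqxx big1 ?addr0 //.
  by move=> U /andP [/andP [OO _] /negPf Oy]; rewrite memO // Oy.
rewrite big1 // => U /andP [OO OF]; rewrite memO //; case: eqP => // Oy.
by rewrite -Oy OF in h.
Qed.

Lemma free_orbit_cycles : free [seq incidence e (arcs U) | U <- enum moved_orbits].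
Proof.
set X := map _ _; have -> : X = in_tuple X by [].
apply/freeP => c c0 i.
have sizeX : size X = size (enum moved_orbits) by rewrite size_map.
have szi : (i < size (enum moved_orbits))%N by rewrite -sizeX.
have := mem_nth finset.set0 szi; rewrite mem_enum => /moved_orbitP [x sx Ox].
pose k := enum_rank_in (arc_edge sx) (arc x).
move/rowP/(_ k): c0; rewrite summxE mxE (bigD1 i) //= big1 ?addr0 => [|j ji].
  rewrite !mxE (nth_map finset.set0) // mxE enum_rankK_in ?arc_edge //.
  by rewrite Ox mem_orbit_cycle // porbit_id mulr1.
have szj : (j < size (enum moved_orbits))%N by rewrite -sizeX.
rewrite !mxE (nth_map finset.set0) // mxE enum_rankK_in ?arc_edge //.
have := mem_nth finset.set0 szj; rewrite mem_enum => /moved_orbitP [z sz Oz].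
rewrite Oz mem_orbit_cycle // -eq_porbit_mem -Ox -Oz nth_uniq ?enum_uniq //.
by rewrite eq_sym (inj_eq val_inj) (negPf ji) mulr0.
Qed.

Lemma orbit_cycle_basis :
  cycle_basis e [seq arcs U | U <- enum moved_orbits].
Proof.
apply/andP; split.
  apply/allP => F /mapP [U]; rewrite mem_enum => /moved_orbitP [x sx ->] ->.
  exact: orbit_cycle_simple.
rewrite /basis_of -map_comp free_orbit_cycles andbT eqEsubv; apply/andP; split.
  apply/span_subvP => v /mapP [U]; rewrite mem_enum => /moved_orbitP [x sx ->] ->.
  apply: memv_span; apply/fintype.imageP; exists (arcs (porbit s x)) => //.
  exact: orbit_cycle_is_cycle.
apply/span_subvP => v /fintype.imageP [F cF ->]; rewrite incidence_decomposition //.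
apply: memv_suml => U /andP [UO _]; apply: memv_span.
by apply/mapP; exists U; rewrite ?mem_enum.
Qed.

(** Optimality of [l]: a nonempty even subgraph contains a full orbit, so no
    basis can consist of cycles with fewer than [l] edges. *)
Lemma cycle_graph_sparsity : (exists x, s x != x) -> has_cycle_sparsity e l.
Proof.
move=> [x0 sx0].
have inc_neq0 F y : s y != y -> arc y \in F -> incidence e F != 0.
  move=> sy yF; apply/eqP => /rowP /(_ (enum_rank_in (arc_edge sy) (arc y))).
  rewrite !mxE enum_rankK_in ?arc_edge // yF => /eqP.
  by rewrite oner_eq0.
rewrite /has_cycle_sparsity; case: ifP => [/eqP cs0|cs].
  exfalso; have cy := orbit_cycle_is_cycle sx0.
  have : incidence e (arcs (porbit s x0)) \in cycle_space e.
    by apply: memv_span; apply/fintype.imageP; exists (arcs (porbit s x0)).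
  rewrite cs0 memv0; apply/negP; apply: (inc_neq0 _ x0) => //.
  by rewrite mem_orbit_cycle // porbit_id.
split.
  exists [seq arcs U | U <- enum moved_orbits]; first exact: orbit_cycle_basis.
  apply/allP => F /mapP [U]; rewrite mem_enum => /moved_orbitP [x sx ->] ->.
  by rewrite orbit_cycle_induced // card_orbit_cycle // leqnn.
move=> k [[|F B] /andP [/= simp bas] small].
  by move: cs; rewrite -(span_basis bas) span_nil eqxx.
have /andP [/andP [cF _] _] := simp; have /andP [/andP [_ Fk] _] := small.
have F0 : incidence e F != 0.
  by have := basis_not0 bas; apply; rewrite inE eqxx.
have [E EF] : exists E, E \in F.
  apply/finset.set0Pn; apply: contraNneq F0 => ->; apply/eqP/rowP => i.
  by rewrite !mxE inE.
have Fe : F \subset edges e by case/and3P: cF.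
have [x sx Ex] := edgeP (fintype.subsetP Fe _ EF).
rewrite -(card_orbit_cycle sx); apply: leq_trans Fk; apply: subset_leq_card.
apply/fintype.subsetP => _ /finset.imsetP [y yx ->].
by rewrite (cycle_constant_on_orbit cF sx yx) -Ex.
Qed.

End CycleGraphSparsity.

(** * Determinants of matrices with mixed rows; diagonal dominance *)

Section RowMixing.
Variables (R : comPzRingType) (n : nat).
Implicit Types (A B M : 'M[R]_n) (Y : {set 'I_n}).

Definition mix_rows Y A B : 'M[R]_n :=
  \matrix_(i, j) (if i \in Y then A i j else B i j).

(** Multilinearity of the determinant in the rows outside [J]. *)
Lemma sum_det_mix_rows (J : {set 'I_n}) A B :
  \sum_(Y : {set 'I_n} | J \subset Y) \det (mix_rows Y A B) =
  \det (mix_rows J A (A + B)).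
Proof.
rewrite /determinant exchange_big /=; apply: eq_bigr => s _.
rewrite -big_distrr /=; congr (_ * _).
transitivity (\prod_i (A i (s i) + (if i \in J then 0 else B i (s i)))); last first.
  by apply: eq_bigr => i _; rewrite !mxE; case: ifP => // _; rewrite addr0.
rewrite bigA_distr big_mkcond /=; apply: eq_bigr => Y _.
have [/fintype.subsetP JY|/subsetPn [i iJ iY]] := boolP (J \subset Y).
  apply: eq_bigr => i _; rewrite mxE; case: ifP => // iY.
  by case: ifP => // /JY; rewrite iY.
by rewrite (bigD1 i) //= (negPf iY) iJ mul0r.
Qed.

(** Sylvester's identity, from two triangular factorizations of the block
    matrix with rows [1, - A] and [B, 1]. *)
Lemma det_1D_mulmx (m : nat) (A : 'M[R]_(n, m)) (B : 'M[R]_(m, n)) :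
  \det (1%:M + A *m B) = \det (1%:M + B *m A).
Proof.
transitivity (\det (block_mx 1%:M (- A) B 1%:M)).
  transitivity (\det (block_mx (1%:M + A *m B) (- A) 0 1%:M
                      *m block_mx 1%:M 0 B 1%:M)).
    by rewrite det_mulmx det_ublock det_lblock !det1 !mulr1.
  rewrite mulmx_block !mulmx1 !mul0mx !mul1mx ?mulmx0 !add0r.
  by rewrite mulNmx addrK.
transitivity (\det (block_mx 1%:M 0 B 1%:M
                    *m block_mx 1%:M (- A) 0 (1%:M + B *m A))).
  rewrite mulmx_block !mulmx1 !mul0mx !mul1mx !addr0.
  by rewrite mulmxN addrCA addNr addr0.
by rewrite det_mulmx det_ublock det_lblock !det1 !mul1r.
Qed.

(** Writing [M] as a product of two matrices of full size, each equal to the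
    identity on the rows of the other, avoids any reindexing of the blocks. *)
Lemma det_mix_rows_block (B : {set 'I_n}) M :
    (forall i j, (i \in B) != (j \in B) -> M i j = 0) ->
  \det M = \det (mix_rows B M 1%:M) * \det (mix_rows B 1%:M M).
Proof.
move=> M0; rewrite -det_mulmx; congr (\det _); apply/matrixP => i j.
rewrite mxE; case: (boolP (i \in B)) => iB; last first.
  rewrite (bigD1 i) //= !mxE (negPf iB) eqxx mul1r big1 ?addr0 // => k ki.
  by rewrite !mxE (negPf iB) eq_sym (negPf ki) mul0r.
under eq_bigr => k _ do rewrite !mxE iB.
rewrite (bigD1 j) //= big1 ?addr0 => [|k kj].
  case: (boolP (j \in B)) => jB; first by rewrite eqxx mulr1.
  by rewrite M0 ?mul0r // iB (negPf jB).
case: (boolP (k \in B)) => kB; first by rewrite (negPf kj) mulr0.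
by rewrite M0 ?mul0r // iB (negPf kB).
Qed.

End RowMixing.

(** With [S] the row selection matrix of [J], the left-hand matrix is
    [1 + S^T (S (K - 1))]; Sylvester's identity swaps the two factors. *)
Lemma det_mix_rows_1 (R : realType) (N : nat) (J : {set 'I_N}) (K : 'M[R]_N) :
  \det (mix_rows J K 1%:M) = \det (principal_submx K J).
Proof.
pose S : 'M[R]_(#|J|, N) := rowsub enum_val 1%:M.
have SM (M : 'M[R]_N) : S *m M = rowsub enum_val M.
  by rewrite mul_rowsub_mx mul1mx.
have MS p (M : 'M[R]_(p, N)) : M *m S^T = colsub enum_val M.
  apply/matrixP => i j; rewrite !mxE (bigD1 (enum_val j)) //= !mxE eqxx mulr1.
  rewrite big1 ?addr0 // => k; rewrite eq_sym => /negPf kj.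
  by rewrite !mxE kj mulr0.
have -> : mix_rows J K 1%:M = 1%:M + S^T *m (S *m (K - 1%:M)).
  apply/matrixP => i j; rewrite !mxE.
  case: ifP => iJ.
    rewrite (bigD1 (enum_rank_in iJ i)) //= SM !mxE enum_rankK_in // eqxx mul1r.
    rewrite big1 ?addr0 => [|k ki]; first by rewrite addrC subrK.
    rewrite !mxE; case: eqP => [ki'|]; last by rewrite mul0r.
    by rewrite -[k](enum_valK_in iJ) ki' eqxx in ki.
  rewrite big1 ?addr0 // => k _; rewrite !mxE.
  by case: eqP (enum_valP k) => [->|]; rewrite ?iJ ?mul0r.
rewrite det_1D_mulmx SM; congr (\det _).
apply/matrixP => i j; rewrite MS !mxE (inj_eq enum_val_inj).
by rewrite addrC subrK.
Qed.

Section DiagonalDominance.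
Variable R : realFieldType.

(** Ostrowski's lower bound.  A Schur complement step with pivot [a = M 0 0]
    preserves the dominance with the same margins: the decrease of a
    diagonal entry plus the increase of the absolute sum of the other entries
    of its row is at most the modulus of the entry that has been eliminated.
    Separate margins per row are needed to apply the bound to matrices that
    are the identity outside a block. *)
Lemma det_ge_prod_dominance (n : nat) (M : 'M[R]_n) (c : 'I_n -> R) :
    (forall i, 0 <= c i) ->
    (forall i, c i + \sum_(j | j != i) `|M i j| <= M i i) ->
  \prod_i c i <= \det M.
Proof.
elim: n M c => [|n IHn] M c c0 cM; first by rewrite big_ord0 det_mx00.
pose a := M 0 0; pose u j := M 0 (lift 0 j); pose v i := M (lift 0 i) 0.
have au : c 0 + \sum_j `|u j| <= a.
  by have := cM 0; rewrite big_mkcond big_ord_recl /= add0r.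
have su0 : 0 <= \sum_j `|u j| by apply: sumr_ge0.
have ca : c 0 <= a by move: au su0; lra.
(* a zero pivot forces the whole first row, hence both sides, to vanish *)
have [a0|a0] := eqVneq a 0.
  have c00 : c 0 = 0 by apply/le_anti; rewrite c0 andbT -a0.
  rewrite big_ord_recl c00 mul0r.
  rewrite (expand_det_row _ 0) big1 // => j _.
  suff -> : M 0 j = 0 by rewrite mul0r.
  have [->//|j0] := eqVneq j 0.
  apply/eqP; rewrite -normr_le0; have := cM 0.
  rewrite -/a a0 c00 add0r (bigD1 j) //=; apply: le_trans.
  by rewrite lerDl sumr_ge0.
have {}a0 : 0 < a by rewrite lt_neqAle eq_sym a0 (le_trans (c0 0)).
pose W : 'M[R]_n := \matrix_(i, j) (M (lift 0 i) (lift 0 j) - v i * u j / a).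
have -> : \det M = a * \det W.
  pose L : 'M[R]_(1 + n) := block_mx 1%:M 0 (\col_i (v i / a)) 1%:M.
  pose U : 'M[R]_(1 + n) := block_mx a%:M (\row_j u j) 0 W.
  have -> : M = L *m U.
    rewrite mulmx_block !mul1mx !mul0mx !addr0.
    have lE (k : 'I_n) : rshift 1 k = lift 0 k by apply/val_inj.
    have oE (k : 'I_1) : lshift n k = 0 by rewrite ord1; apply/val_inj.
    apply: etrans (esym (@submxK _ 1 n 1 n M)) _.
    congr (block_mx _ _ _ _); apply/matrixP => i j.
    - by rewrite 2!mxE !oE !mxE !ord1 eqxx mulr1n.
    - by rewrite 2!mxE oE lE !mxE.
    - rewrite 2!mxE oE lE !mxE big_ord1 !mxE !ord1 eqxx mulr1n.
      by rewrite divfK // gt_eqF.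
    - rewrite 2!mxE !lE !mxE big_ord1 !mxE.
      by rewrite addrC mulrAC subrK.
  rewrite det_mulmx (@det_lblock _ 1 n) (@det_ublock _ 1 n) !det1 !mul1r.
  by rewrite det_scalar1.
rewrite big_ord_recl; apply: ler_pM => //; first exact: prodr_ge0.
apply: IHn => // i.
have ua j : `|u j| <= \sum_k `|u k| by rewrite (bigD1 j) //= lerDl sumr_ge0.
pose t := \sum_(j | j != i) `|u j|.
have tE : \sum_j `|u j| = `|u i| + t by rewrite (bigD1 i).
pose w := \sum_(j | j != i) `|M (lift 0 i) (lift 0 j)|.
have hM : c (lift 0 i) + `|v i| + w <= M (lift 0 i) (lift 0 i).
  have := cM (lift 0 i); rewrite [X in _ + X]big_mkcond big_ord_recl /= -big_mkcond /=.
  by rewrite addrA.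
have hW : \sum_(j | j != i) `|W i j| <= w + `|v i| * (t / a).
  rewrite mulr_suml mulr_sumr -big_split /=; apply: ler_sum => j _.
  rewrite mxE (le_trans (ler_normB _ _)) // lerD2l !normrM normfV.
  by rewrite (gtr0_norm a0) mulrA.
rewrite [W i i]mxE.
have hd : v i * u i / a <= `|v i| * (`|u i| / a).
  rewrite mulrA -normrM ler_pM2r ?invr_gt0 //; exact: ler_norm.
have : `|v i| * (`|u i| / a) + `|v i| * (t / a) <= `|v i|.
  rewrite -mulrDr -mulrDl -tE ler_piMr // ler_pdivrMr // mul1r.
  by move: au (c0 0); lra.
by move: hM hW hd; lra.
Qed.

(** Expanding the right-hand side gives one term per self-map of the indices;
    the permutations among them give the Leibniz formula. *)
Lemma norm_det_le_prod_rows (n : nat) (M : 'M[R]_n) :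
  `|\det M| <= \prod_i \sum_j `|M i j|.
Proof.
apply: (le_trans (ler_norm_sum _ _ _)).
rewrite bigA_distr_bigA /=.
under eq_bigr => s _ do rewrite normrM normrX normrN1 expr1n mul1r normr_prod.
rewrite [leRHS](bigID (fun f : {ffun 'I_n -> 'I_n} => injectiveb f)) /=.
rewrite (reindex (@pval _)) /=; last first.
  have in_Sn : {on [pred f : {ffun 'I_n -> 'I_n} | injectiveb f], bijective (@pval _)}.
    by exists (insubd (1%g : 'S_n)) => /= f Uf; first apply: val_inj; exact: insubdK.
  exact: in_Sn.
under [X in _ <= X + _]eq_bigl => s do rewrite (valP s).
apply: ler_wpDr; first by apply: sumr_ge0 => f _; apply: prodr_ge0.
by apply: ler_sum => s _; apply: ler_prod => i _; rewrite normr_ge0 pvalE lexx.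
Qed.
End DiagonalDominance.

(** * The mass function of a DPP and its block factorization *)

Lemma psd_dominance (R : realType) (N : nat) (M : 'M[R]_N) :
    M^T = M -> (forall i, \sum_(j | j != i) `|M i j| <= M i i) -> psd M.
Proof.
move=> Msym Mdom; split=> // x.
pose a i j := if j != i then `|M i j| else 0.
have aC i j : a i j = a j i by rewrite /a eq_sym -{1}Msym mxE.
have E : (x^T *m M *m x) 0 0 = \sum_i \sum_j x i 0 * M i j * x j 0.
  rewrite mxE exchange_big /=; apply: eq_bigr => j _.
  by rewrite mxE mulr_suml; apply: eq_bigr => i _; rewrite mxE.
(* 2 |x_i x_j| <= x_i^2 + x_j^2 on the entries off the diagonal *)
have lb i : M i i * x i 0 ^+ 2 - \sum_j a i j * (x i 0 ^+ 2 + x j 0 ^+ 2) / 2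
    <= \sum_j x i 0 * M i j * x j 0.
  rewrite (bigD1 i) //= [leRHS](bigD1 i) //=.
  rewrite /a eqxx /= !mul0r add0r.
  have -> : x i 0 * M i i * x i 0 = M i i * x i 0 ^+ 2 by ring.
  rewrite lerD2l -sumrN; apply: ler_sum => j ji; rewrite ji.
  have := ler_norm (- (M i j * x i 0 * x j 0)).
  rewrite normrN -mulrA normrM => h.
  have : `|x i 0 * x j 0| <= (x i 0 ^+ 2 + x j 0 ^+ 2) / 2.
    rewrite ler_norml; apply/andP; split.
      by have := sqr_ge0 (x i 0 + x j 0); rewrite sqrrD; lra.
    by have := sqr_ge0 (x i 0 - x j 0); rewrite sqrrB; lra.
  move=> /(ler_wpM2l (normr_ge0 (M i j))); lra.
rewrite E; apply: le_trans (ler_sum _ (fun i _ => lb i)).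
rewrite sumrB.
have -> : \sum_i \sum_j a i j * (x i 0 ^+ 2 + x j 0 ^+ 2) / 2
    = \sum_i \sum_j a i j * x i 0 ^+ 2.
  have S : \sum_i \sum_j a i j * x i 0 ^+ 2 = \sum_i \sum_j a i j * x j 0 ^+ 2.
    rewrite exchange_big /=; apply: eq_bigr => i _; apply: eq_bigr => j _.
    by rewrite aC.
  rewrite -[RHS](_ : (\sum_i \sum_j a i j * x i 0 ^+ 2 +
     \sum_i \sum_j a i j * x j 0 ^+ 2) / 2 = _); last by rewrite -S; lra.
  rewrite -big_split /= mulr_suml; apply: eq_bigr => i _.
  rewrite -big_split /= mulr_suml; apply: eq_bigr => j _.
  by rewrite mulrDr.
rewrite -sumrB; apply: sumr_ge0 => i _.
rewrite -mulr_suml -mulrBl mulr_ge0 ?sqr_ge0 // subr_ge0.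
by apply: le_trans (Mdom i); rewrite /a -big_mkcond.
Qed.

Section DPPmass.
Variables (R : realType) (N : nat).
Implicit Types (K : 'M[R]_N) (B Y : {set 'I_N}).

(** The determinant of this matrix is the probability that the random set is
    exactly [Y]: summing it over the supersets of [J] replaces the rows outside
    [J] by those of [K + (1 - K) = 1]. *)
Definition dpp_mx K Y : 'M[R]_N := mix_rows Y K (1%:M - K).

Definition dpp_pmf K Y : R := \det (dpp_mx K Y).

(** The factor of the mass function contributed by a block [B]; the identity
    rows outside [B] make it depend on the rows of [K] in [B] only. *)
Definition block_det B K Y : R := \det (mix_rows B (dpp_mx K Y) 1%:M).

Lemma sum_dpp_pmf_supset K (J : {set 'I_N}) :
  \sum_(Y : {set 'I_N} | J \subset Y) dpp_pmf K Y = \det (principal_submx K J).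
Proof. by rewrite sum_det_mix_rows addrC subrK det_mix_rows_1. Qed.

Lemma sum_dpp_pmf K : \sum_Y dpp_pmf K Y = 1.
Proof.
transitivity (\sum_(Y : {set 'I_N} | finset.set0 \subset Y) dpp_pmf K Y).
  by apply: eq_bigl => Y; rewrite finset.sub0set.
rewrite sum_dpp_pmf_supset; move: (principal_submx _ _).
by rewrite cards0 => M; rewrite det_mx00.
Qed.

(** Dominance with margin [c] of [K] and of [1 - K] simultaneously, hence of
    every [dpp_mx K Y]. *)
Definition dominated (c : R) K := forall i,
  c + \sum_(j | j != i) `|K i j| <= K i i /\
  c + \sum_(j | j != i) `|K i j| <= 1 - K i i.

Lemma mix_rows_dominated (c : R) K Y : dominated c K -> forall i,
  c + \sum_(j | j != i) `|dpp_mx K Y i j| <= dpp_mx K Y i i.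
Proof.
move=> Kdom i; have [Kd1 Kd2] := Kdom i.
rewrite !mxE eqxx mulr1n; case: ifP => iY.
  rewrite (eq_bigr (fun j => `|K i j|)) // => j ji.
  by rewrite !mxE iY.
rewrite (eq_bigr (fun j => `|K i j|)) // => j ji.
by rewrite !mxE iY eq_sym (negPf ji) add0r normrN.
Qed.

Lemma dominated_kernel K : K^T = K -> dominated 0 K -> is_kernel K.
Proof.
move=> Ksym Kdom; split=> //; apply: psd_dominance => //.
- by move=> i; have [+ _] := Kdom i; rewrite add0r.
- by rewrite linearB /= trmx1 Ksym.
move=> i; have := mix_rows_dominated finset.set0 Kdom i.
rewrite add0r !mxE inE; apply: le_trans.
by apply: ler_sum => j _; rewrite [in leRHS]mxE inE.
Qed.

Lemma dpp_pmf_ge_exp (c : R) K Y : 0 <= c -> dominated c K -> c ^+ N <= dpp_pmf K Y.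
Proof.
move=> c0 Kdom; rewrite -[N in c ^+ N]card_ord -prodr_const.
exact: det_ge_prod_dominance (mix_rows_dominated Y Kdom).
Qed.

Lemma dpp_pmf_ge0 K Y : dominated 0 K -> 0 <= dpp_pmf K Y.
Proof.
move=> Kdom; apply: le_trans (dpp_pmf_ge_exp Y (lexx 0) Kdom).
exact: exprn_ge0.
Qed.

Lemma is_dpp_pmf K : dominated 0 K -> is_dpp K (dpp_pmf K).
Proof.
move=> Kdom; split=> [Y||J]; first exact: dpp_pmf_ge0.
  exact: sum_dpp_pmf.
exact: sum_dpp_pmf_supset.
Qed.

(** Dominance of [1 - K] bounds the row sums of [K], and conversely. *)
Lemma norm_row_mix_rows_le1 K B Y : dominated 0 K -> forall i,
  \sum_j `|mix_rows B (dpp_mx K Y) 1%:M i j| <= 1.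
Proof.
move=> Kdom i; rewrite (bigD1 i) //=.
case: (boolP (i \in B)) => iB; last first.
  rewrite mxE (negPf iB) mxE eqxx normr1 big1 ?addr0 // => j ji.
  by rewrite mxE (negPf iB) mxE eq_sym (negPf ji) normr0.
have [Kd1 Kd2] := Kdom i.
have S : 0 <= \sum_(j | j != i) `|K i j| by apply: sumr_ge0.
have -> : \sum_(j | j != i) `|mix_rows B (dpp_mx K Y) 1%:M i j|
    = \sum_(j | j != i) `|K i j|.
  apply: eq_bigr => j ji; rewrite 2!mxE iB !mxE.
  by case: ifP => // _; rewrite eq_sym (negPf ji) add0r normrN.
rewrite 2!mxE iB !mxE eqxx mulr1n.
by case: ifP => _; rewrite ger0_norm; lra.
Qed.

Definition block_diag B K := forall i j, (i \in B) != (j \in B) -> K i j = 0.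

Lemma dpp_pmf_block B K Y : block_diag B K ->
  dpp_pmf K Y = block_det B K Y * \det (mix_rows B 1%:M (dpp_mx K Y)).
Proof.
move=> KB; apply: det_mix_rows_block => i j ij.
rewrite !mxE KB // subr0; case: ifP => // _.
by case: (eqVneq i j) ij => [->|//]; rewrite eqxx.
Qed.

Lemma mix_rows_eqin B K K' Y : (forall i j, i \in B -> K' i j = K i j) ->
  mix_rows B (dpp_mx K' Y) 1%:M = mix_rows B (dpp_mx K Y) 1%:M.
Proof.
by move=> KK; apply/matrixP => i j; rewrite !mxE; case: ifP => // iB; rewrite KK.
Qed.

Lemma mix_rows_eqout B K K' Y : (forall i j, i \notin B -> K' i j = K i j) ->
  mix_rows B 1%:M (dpp_mx K' Y) = mix_rows B 1%:M (dpp_mx K Y).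
Proof.
move=> KK; apply/matrixP => i j; rewrite !mxE; case: ifP => // iB.
by rewrite KK // iB.
Qed.

(** The orthogonality of perturbations of different blocks: [K1] and [K2]
    differ from [K0] inside and outside [B] respectively, and [K12] carries both
    perturbations.  After division by the mass function of [K0], the product
    is again a mass function, so it sums to 1. *)
Lemma dpp_pmf_cross B K0 K1 K2 K12 Y :
    block_diag B K0 -> block_diag B K1 -> block_diag B K2 -> block_diag B K12 ->
    (forall i j, i \in B -> K1 i j = K12 i j) ->
    (forall i j, i \notin B -> K1 i j = K0 i j) ->
    (forall i j, i \in B -> K2 i j = K0 i j) ->
    (forall i j, i \notin B -> K2 i j = K12 i j) ->
  dpp_pmf K1 Y * dpp_pmf K2 Y = dpp_pmf K0 Y * dpp_pmf K12 Y.
Proof.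
move=> B0 B1 B2 B12 in1 out1 in2 out2; rewrite !(@dpp_pmf_block B) // /block_det.
rewrite (mix_rows_eqin _ in1) (mix_rows_eqin _ in2).
rewrite (mix_rows_eqout _ out1) (mix_rows_eqout _ out2); ring.
Qed.

(** The factor outside [B] is common to both mass functions, and the factor of
    [K] on [B] is at least [c ^+ #|B|] by diagonal dominance. *)
Lemma dpp_pmf_perturb B K K' Y (c Delta : R) :
    0 < c -> dominated c K -> block_diag B K -> block_diag B K' ->
    (forall i j, i \notin B -> K' i j = K i j) ->
    `|block_det B K' Y - block_det B K Y| <= Delta ->
  `|dpp_pmf K' Y - dpp_pmf K Y| <= Delta / c ^+ #|B| * dpp_pmf K Y.
Proof.
move=> c0 Kdom BK BK' KK'; rewrite !(@dpp_pmf_block B) //.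
rewrite (mix_rows_eqout _ KK').
rewrite /block_det.
set a' := \det _; set a := \det _; set r := \det _ => aa'.
have D := mix_rows_dominated Y Kdom.
have D0 i : \sum_(j | j != i) `|dpp_mx K Y i j| <= dpp_mx K Y i i by have := D i; lra.
have row1 i : 1 + \sum_(j | j != i) `|(1%:M : 'M[R]_N) i j| = 1.
  by rewrite big1 ?addr0 // => j ji; rewrite mxE eq_sym (negPf ji) normr0.
have r0 : 0 <= r.
  apply: le_trans (_ : \prod_(i < N) (if i \in B then 1 else 0) <= _).
    by apply: prodr_ge0 => i _; case: ifP.
  apply: det_ge_prod_dominance => i; first by case: ifP.
  rewrite mxE; case: ifP => iB; last first.
    by rewrite add0r; under eq_bigr => j _ do rewrite mxE iB.
  by under eq_bigr => j _ do rewrite mxE iB; rewrite row1 mxE eqxx.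
have a0 : c ^+ #|B| <= a.
  rewrite -prodr_const big_mkcond /=.
  apply: det_ge_prod_dominance => i; first by case: ifP => // _; apply: ltW.
  rewrite mxE; case: ifP => iB.
    by under eq_bigr => j _ do rewrite mxE iB.
  by under eq_bigr => j _ do rewrite mxE iB; rewrite row1 mxE eqxx.
rewrite -mulrBl normrM (ger0_norm r0) mulrA ler_wpM2r //.
apply: (le_trans aa'); rewrite -mulrA -[leLHS]mulr1 ler_wpM2l //.
  exact: le_trans aa'.
by rewrite mulrC ler_pdivlMr ?exprn_gt0 // mul1r.
Qed.

End DPPmass.

(** * Effect of reversing one edge of a cycle on a determinant *)

Section CycleDeterminant.
Variables (R : realFieldType) (n : nat).
Implicit Types (s t : {perm 'I_n}) (x y i j : 'I_n).

(** A permutation that moves every point of a cycle by at most one step, and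
    takes the step from [x] to [s x] without coming back, has no choice but to
    go on in the same direction: the previous points are already attained.
    The induction carries two consecutive points for this reason. *)
Lemma perm_follows_cycle s t x :
    (forall y, y \in porbit s x -> s (s y) != y) ->
    (forall y, y \in porbit s x -> [|| t y == y, t y == s y | s (t y) == y]) ->
    t x = s x -> t (s x) <> x ->
  forall y, y \in porbit s x -> t y = s y.
Proof.
move=> s2 tadj tx tsx _ /porbit_iterP [k ->].
have mem := mem_porbit_iter s x.
suff [] : t (iter k s x) = iter k.+1 s x /\
    t (iter k.+1 s x) = iter k.+2 s x by [].
elim: k => [|k [IH1 IH2]]; split=> //.
  have /or3P [/eqP e|/eqP//|/eqP /perm_inj //] := tadj _ (mem 1%N).
  have := s2 x (mem 0); have : s x = x by apply: (@perm_inj _ t); rewrite tx e.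
  by move=> sx; rewrite !sx eqxx.
have /or3P [/eqP e|/eqP//|/eqP /perm_inj e] := tadj _ (mem k.+2).
  have h : iter k.+2 s x = iter k.+1 s x by apply: (@perm_inj _ t); rewrite e IH2.
  have {}h : s (iter k.+1 s x) = iter k.+1 s x := h.
  by have := s2 _ (mem k.+1); rewrite !h eqxx.
have h : iter k.+2 s x = iter k s x.
  by apply: (@perm_inj _ t); rewrite e IH1.
by have := s2 _ (mem k); rewrite -!iterS h eqxx.
Qed.

Definition only_on s (A : {set 'I_n}) : {set {perm 'I_n}} :=
  [set t : {perm 'I_n} | [forall i, t i == if i \in A then s i else i]].

Lemma card_only_on s A : (#|only_on s A| <= 1)%N.
Proof.
apply/card_le1_eqP => t t'; rewrite !inE => /forallP ht /forallP ht'.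
by apply/permP => i; rewrite (eqP (ht i)) (eqP (ht' i)).
Qed.

Lemma norm_prod_only_on (M : 'M[R]_n) (a : R) s A t :
    t \in only_on s A -> (forall i, i \notin A -> M i i = 1) ->
    (forall i, i \in A -> `|M i (s i)| <= a) ->
  `|\prod_i M i (t i)| <= a ^+ #|A|.
Proof.
rewrite inE => /forallP ht M1 Ma.
rewrite normr_prod -prodr_const [leRHS]big_mkcond /=.
apply: ler_prod => i _; rewrite normr_ge0 (eqP (ht i)) /=.
by case: ifP => iA; [exact: Ma | rewrite M1 ?iA ?normr1].
Qed.

(** In the Leibniz formula, the term of [t] is changed only if [t] uses exactly
    one of the two symmetric entries of the edge.  If this term is nonzero, [t]
    follows the cycle forwards or backwards and is the identity elsewhere.
    There are at most two such [t], each with a term of modulus at most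
    [a ^+ #|porbit s x|] in both matrices. *)
Lemma det_flip_cycle_edge s x (a : R) (M M' : 'M[R]_n) :
    (forall y, y \in porbit s x -> s (s y) != y) ->
    (forall i, i \notin porbit s x -> forall j, M i j = (i == j)%:R) ->
    (forall i j, i \in porbit s x -> j != i -> j != s i -> s j != i -> M i j = 0) ->
    (forall i, i \in porbit s x -> `|M i (s i)| <= a /\ `|M (s i) i| <= a) ->
    (forall i j, M' i j =
       (-1) ^+ ((i == x) && (j == s x) || (i == s x) && (j == x)) * M i j) ->
  `|\det M' - \det M| <= 4 * a ^+ #|porbit s x|.
Proof.
move=> s2 Mout Mzero Ma M'E; set B := porbit s x.
have xB : x \in B by apply: porbit_id.
have sxx : s x != x.
  by apply: contraNneq (s2 x xB) => e; rewrite !e.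
pose t0 (t : {perm 'I_n}) := \prod_i M i (t i).
have M'prod (t : {perm 'I_n}) :
    \prod_i M' i (t i) = (-1) ^+ ((t x == s x) (+) (t (s x) == x)) * t0 t.
  under eq_bigr => i _ do rewrite M'E.
  rewrite big_split /=; congr (_ * _).
  rewrite (bigD1 x) //= (bigD1 (s x)) ?sxx //= big1 ?mulr1 => [|i /andP[ix isx]].
    by rewrite !eqxx [x == _]eq_sym (negPf sxx) /= orbF -signr_addb.
  by rewrite (negPf ix) (negPf isx).
have sVB : porbit (s^-1)%g (s x) = B.
  by rewrite porbitV; apply/eqP; rewrite eq_porbit_mem mem_porbit_perm porbit_id.
have inB i : (s i \in B) = (i \in B) by apply: mem_porbit_perm.
have inBV i : ((s^-1)%g i \in B) = (i \in B) by rewrite -[LHS]inB permKV.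
pose S1 := only_on s B; pose S2 := only_on (s^-1)%g B.
have bound t : `|\prod_i M' i (t i) - t0 t| <=
    2 * a ^+ #|B| * ((t \in S1)%:R + (t \in S2)%:R).
  have a0 : 0 <= a by apply: le_trans (Ma x xB).1.
  have aB : 0 <= a ^+ #|B| by apply: exprn_ge0.
  have [tM0|tM0] := eqVneq (t0 t) 0.
    by rewrite M'prod tM0 mulr0 subr0 normr0 !mulr_ge0 // addr_ge0.
  have tM i : M i (t i) != 0 by move/prodf_neq0: tM0 => /(_ i isT).
  have tout i : i \notin B -> t i = i.
    move=> iB; have := tM i; rewrite Mout //.
    by case: (eqVneq i (t i)) => [<-//|_]; rewrite eqxx.
  have tadj i : i \in B -> [|| t i == i, t i == s i | s (t i) == i].
    move=> iB; have := tM i; apply: contraNT.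
    by rewrite !negb_or => /and3P[h1 h2 h3]; rewrite Mzero.
  have M1 i : i \notin B -> M i i = 1 by move=> iB; rewrite Mout // eqxx.
  have [e|] := eqVneq (t x == s x) (t (s x) == x).
    rewrite M'prod e addbb mul1r subrr normr0 !mulr_ge0 // addr_ge0 //; exact: ler0n.
  move=> ne.
  have nrm : `|t0 t| <= a ^+ #|B| ->
      `|\prod_i M' i (t i) - t0 t| <= 2 * a ^+ #|B|.
    move=> h; rewrite M'prod; apply: le_trans (ler_normB _ _) _.
    by rewrite normrMsign; lra.
  case tx: (t x == s x) ne => ne.
    have tS1 : t \in S1.
      rewrite inE; apply/forallP => i; case: ifP => iB; last by rewrite tout ?iB.
      apply/eqP; apply: (perm_follows_cycle s2) iB => //; first exact/eqP.
      by move/eqP => h; rewrite h in ne.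
    rewrite tS1; apply: (le_trans (nrm _)).
      by apply: norm_prod_only_on tS1 M1 _ => i /Ma [].
    by rewrite ler_peMr ?mulr_ge0 // lerDl ler0n.
  have tsx : t (s x) = x by apply/eqP; move: ne; case: (_ == x).
  have tS2 : t \in S2.
    rewrite inE; apply/forallP => i; case: ifP => iB; last by rewrite tout ?iB.
    apply/eqP; apply: (@perm_follows_cycle (s^-1)%g t (s x)); rewrite ?sVB //.
    - move=> y yB; have := s2 ((s^-1)%g ((s^-1)%g y)); rewrite !inBV yB !permKV.
      by rewrite eq_sym; apply.
    - move=> y yB; have := tadj y yB.
      case/or3P => /eqP e; first by rewrite e eqxx.
        by rewrite e permK eqxx !orbT.
      have -> : (s^-1)%g y = t y by rewrite -[in LHS]e permK.
      by rewrite eqxx orbT.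
    - by rewrite permK.
    - by rewrite permK => h; move: tx; rewrite h eqxx.
  rewrite tS2; apply: (le_trans (nrm _)).
    apply: norm_prod_only_on tS2 M1 _ => i iB.
    by have [_] := Ma ((s^-1)%g i) (etrans (inBV i) iB); rewrite permKV.
  by rewrite ler_peMr ?mulr_ge0 // lerDr ler0n.
have -> : \det M' - \det M =
    \sum_(t : {perm 'I_n}) (-1) ^+ t * (\prod_i M' i (t i) - t0 t).
  by rewrite /determinant -sumrB; apply: eq_bigr => t _; rewrite mulrBr.
apply: (le_trans (ler_norm_sum _ _ _)).
under eq_bigr => t _ do rewrite normrMsign.
apply: (le_trans (ler_sum _ (fun t _ => bound t))).
rewrite -mulr_sumr big_split /= -!natr_sum -!big_mkcond /= !sum1_card.
have c1 : (#|S1|%:R : R) <= 1 by rewrite (ler_nat _ _ 1) card_only_on.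
have c2 : (#|S2|%:R : R) <= 1 by rewrite (ler_nat _ _ 1) card_only_on.
have a0 : 0 <= a by apply: le_trans (Ma x xB).1.
have aB : 0 <= a ^+ #|B| by apply: exprn_ge0.
nra.
Qed.

End CycleDeterminant.

(** * One law against a mixture of alternatives *)

Section LeCam.
Variable R : realFieldType.

Lemma sum_tuple_prod (Omega : finType) (n : nat) (f : Omega -> R) :
  \sum_(y : n.-tuple Omega) \prod_(i < n) f (tnth y i) = (\sum_w f w) ^+ n.
Proof.
rewrite -[n in RHS]card_ord -prodr_const bigA_distr_bigA /=.
rewrite (reindex (fun y : n.-tuple Omega => [ffun i => tnth y i])) /=.
  by apply: eq_bigr => y _; apply: eq_bigr => i _; rewrite ffunE.
exists (fun g : {ffun 'I_n -> Omega} => [tuple g i | i < n]) => [y _|g _].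
  by apply: eq_from_tnth => i; rewrite tnth_mktuple ffunE.
by apply/ffunP => i; rewrite ffunE tnth_mktuple.
Qed.

Variables (Omega I : finType) (p0 : Omega -> R) (p : I -> Omega -> R) (eta : R).
Hypothesis p0_gt0 : forall w, 0 < p0 w.
Hypothesis p0_sum : \sum_w p0 w = 1.
Hypothesis p_ge0 : forall b w, 0 <= p b w.
Hypothesis p_sum : forall b, \sum_w p b w = 1.
Hypothesis p_cross : forall b b', b != b' -> \sum_w p b w * p b' w / p0 w = 1.
Hypothesis p_near : forall b w, `|p b w - p0 w| <= eta * p0 w.

Lemma chi_square_le b : \sum_w p b w * p b w / p0 w <= 1 + eta ^+ 2.
Proof.
have E w : p b w * p b w / p0 w =
    p0 w * ((p b w - p0 w) / p0 w) ^+ 2 + 2 * p b w - p0 w.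
  by field; rewrite gt_eqF.
under eq_bigr => w _ do rewrite E.
rewrite sumrB big_split /= -mulr_sumr p_sum p0_sum.
suff : \sum_w p0 w * ((p b w - p0 w) / p0 w) ^+ 2 <= eta ^+ 2 by lra.
rewrite -[leRHS]mulr1 -p0_sum mulr_sumr; apply: ler_sum => w _.
rewrite mulrC ler_wpM2r ?(ltW (p0_gt0 w)) //.
set u := _ / _; have hu : `|u| <= eta.
  by rewrite normrM normfV (gtr0_norm (p0_gt0 w)) ler_pdivrMr.
rewrite -(@real_normK _ u) ?num_real // lerXn2r ?nnegrE //.
exact: le_trans hu.
Qed.

Variable n : nat.
Implicit Types y : n.-tuple Omega.
Let P0 y := \prod_(i < n) p0 (tnth y i).
Let P b y := \prod_(i < n) p b (tnth y i).

(** Expanding the square, the term of [b] and [b'] is the n-th power of the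
    one-sample correlation minus 1, which vanishes for distinct indices. *)
Lemma chi_square_mixture_le :
  \sum_y (\sum_b (P b y - P0 y)) ^+ 2 / P0 y <= #|I|%:R * ((1 + eta ^+ 2) ^+ n - 1).
Proof.
have P0_gt0 y : 0 < P0 y by apply: prodr_gt0.
have E y : (\sum_b (P b y - P0 y)) ^+ 2 / P0 y =
    \sum_b \sum_b' (P b y * P b' y / P0 y - P b y - P b' y + P0 y).
  rewrite expr2 mulr_suml mulr_suml; apply: eq_bigr => b _.
  rewrite mulr_sumr mulr_suml; apply: eq_bigr => b' _.
  by field; rewrite gt_eqF.
under eq_bigr => y _ do rewrite E.
rewrite exchange_big /= mulr_natl -sumr_const; apply: ler_sum => b _.
rewrite exchange_big /=.
have sP b' : \sum_y P b' y = 1 by rewrite sum_tuple_prod p_sum expr1n.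
have sP0 : \sum_y P0 y = 1 by rewrite sum_tuple_prod p0_sum expr1n.
have sPP b' : \sum_y (P b y * P b' y / P0 y - P b y - P b' y + P0 y) =
    (\sum_w p b w * p b' w / p0 w) ^+ n - 1.
  rewrite big_split /= !sumrB !sP sP0 -sum_tuple_prod subrK; congr (_ - _).
  apply: eq_bigr => y _; rewrite -big_split /= -prodfV -big_split /=.
  by [].
rewrite (bigD1 b) //= [X in _ + X]big1 ?addr0 => [|b' bb'].
  rewrite sPP lerD2r lerXn2r ?nnegrE ?chi_square_le ?addr_ge0 ?sqr_ge0 //.
  by apply: sumr_ge0 => w _; rewrite divr_ge0 ?mulr_ge0 // ltW.
by rewrite sPP p_cross 1?eq_sym // expr1n subrr.
Qed.

(** [F0] and [F b] are the failure events under the base law and under the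
    alternative [b].  If all of them had probability below 1/3, [F0] would
    have probability below 1/3 under the base law and at least 2/3 under every
    alternative; this contradicts the chi-square bound. *)
Lemma mixture_le_cam (F0 : pred (n.-tuple Omega)) (F : I -> pred (n.-tuple Omega)) :
    (0 < #|I|)%N -> (1 + eta ^+ 2) ^+ n <= 1 + #|I|%:R / 3 ->
    (forall b y, F0 y || F b y) ->
  1 / 3 <= \sum_(y | F0 y) P0 y \/ exists b, 1 / 3 <= \sum_(y | F b y) P b y.
Proof.
move=> I0 small cover; pose m : R := #|I|%:R.
have m0 : 0 < m by rewrite ltr0n.
have P0_gt0 y : 0 < P0 y by apply: prodr_gt0.
have P_ge0 b y : 0 <= P b y by apply: prodr_ge0.
case: (lerP (1 / 3) (\sum_(y | F0 y) P0 y)) => [|h0]; first by left.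
case: (pselect (exists b, 1 / 3 <= \sum_(y | F b y) P b y)) => [|hb]; first by right.
exfalso; have {}hb b : \sum_(y | F b y) P b y < 1 / 3.
  by rewrite ltNge; apply/negP => h; apply: hb; exists b.
have low b : 2 / 3 <= \sum_(y | F0 y) P b y.
  have sP : \sum_y P b y = 1 by rewrite sum_tuple_prod p_sum expr1n.
  move: sP; rewrite (bigID (F0 : pred _)) /= => sP.
  have : \sum_(y | ~~ F0 y) P b y <= \sum_(y | F b y) P b y.
    rewrite [leRHS](bigID (F0 : pred _)) /=.
    rewrite [X in _ <= _ + X](eq_bigl (fun y => ~~ F0 y)).
      by rewrite lerDr sumr_ge0.
    by move=> y; have := cover b y; case: (F0 y) => /=; rewrite ?andbF ?andbT.
  by have := hb b; lra.
have D1 : m / 3 < \sum_(y | F0 y) \sum_b (P b y - P0 y).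
  rewrite exchange_big /=; under eq_bigr => b _ do rewrite sumrB.
  rewrite sumrB sumr_const -mulr_natl -/m.
  have : m * (2 / 3) <= \sum_b \sum_(y | F0 y) P b y.
    by rewrite /m mulr_natl -sumr_const; apply: ler_sum.
  nra.
(* D <= D^2 / (2 m P0) + m P0 / 2 pointwise, by the AM-GM inequality *)
have D2 : \sum_(y | F0 y) \sum_b (P b y - P0 y) <=
    \sum_(y | F0 y) ((\sum_b (P b y - P0 y)) ^+ 2 / P0 y / (2 * m) + m / 2 * P0 y).
  apply: ler_sum => y _; set D := \sum_b _.
  have : 0 <= (D - m * P0 y) ^+ 2 / (2 * m * P0 y).
    by rewrite divr_ge0 ?sqr_ge0 // !mulr_ge0 ?ltW.
  have -> : (D - m * P0 y) ^+ 2 / (2 * m * P0 y) =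
     D ^+ 2 / P0 y / (2 * m) + m / 2 * P0 y - D by field; rewrite !gt_eqF.
  by rewrite subr_ge0.
have D3 : \sum_(y | F0 y) (\sum_b (P b y - P0 y)) ^+ 2 / P0 y <=
    m * ((1 + eta ^+ 2) ^+ n - 1).
  apply: le_trans chi_square_mixture_le; rewrite [leRHS](bigID (F0 : pred _)) /= lerDl.
  by apply: sumr_ge0 => y _; rewrite divr_ge0 ?sqr_ge0 // ltW.
move: D2; rewrite big_split /= -mulr_suml -mulr_sumr => D2.
set S := \sum_(y | F0 y) _ / _ in D2 D3.
have D4 : S / (2 * m) <= m / 6.
  rewrite ler_pdivrMr ?mulr_gt0 //; apply: (le_trans D3); rewrite -/m in small.
  nra.
set Q := \sum_(y | F0 y) P0 y in D2 h0.
have : m / 2 * Q <= m / 6 by nra.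
by lra.
Qed.

End LeCam.

(** * Kernels supported on a cycle graph *)

Section CycleKernel.
Variables (R : realType) (N : nat) (s : {perm 'I_N}) (a : R).
Hypothesis s2_neq : forall x, s x != x -> s (s x) != x.
Hypothesis a_gt0 : 0 < a.
Implicit Types (d : 'I_N -> R) (X Y : {set 'I_N}) (x i j : 'I_N).

(** [X] is the set of the points [x] whose edge to [s x] has weight [- a]; all
    other edges of the cycle graph have weight [a]. *)
Definition cycle_kernel d X : 'M[R]_N := \matrix_(i, j)
  if i == j then d i
  else if j == s i then (-1) ^+ (i \in X) * a
  else if i == s j then (-1) ^+ (j \in X) * a
  else 0.

Lemma both_arcs i j : j == s i -> i == s j -> i = j.
Proof.
move=> /eqP -> /eqP e; apply/eqP; rewrite eq_sym; apply: contraT => /s2_neq.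
by rewrite -e eqxx.
Qed.

Lemma cycle_kernel_sym d X : (cycle_kernel d X)^T = cycle_kernel d X.
Proof.
apply/matrixP => i j; rewrite !mxE eq_sym; case: eqVneq => [->//|ij].
case: eqP => [e1|_]; case: eqP => [e2|_] //.
by have := both_arcs (introT eqP e2) (introT eqP e1) => e; rewrite e eqxx in ij.
Qed.

Lemma norm_cycle_kernel_off d X i j : i != j ->
  `|cycle_kernel d X i j| = a *+ cycle_graph s i j.
Proof.
move=> ij; rewrite mxE /cycle_graph ij (negPf ij).
case: ifP => _; first by rewrite normrMsign gtr0_norm.
by case: ifP => _ /=; rewrite ?normr0 ?mulr0n // normrMsign gtr0_norm.
Qed.

Lemma induced_graph_cycle_kernel d X : induced_graph (cycle_kernel d X) = cycle_graph s.
Proof.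
apply/funext => i; apply/funext => j; rewrite /induced_graph.
case: (boolP (i == j)) => ij; first by rewrite /cycle_graph ij.
rewrite -normr_eq0 norm_cycle_kernel_off //.
by case: (cycle_graph s i j); rewrite ?mulr1n ?mulr0n ?eqxx ?gt_eqF.
Qed.

Lemma cycle_kernel_offdiag d X i j : (i < j)%N ->
  cycle_kernel d X i j = 0 \/ a <= `|cycle_kernel d X i j|.
Proof.
move=> ij; have {}ij : i != j by apply: contraTneq ij => ->; rewrite ltnn.
have := norm_cycle_kernel_off d X ij; case: (cycle_graph s i j) => [->|/eqP].
  by right.
by rewrite mulr0n normr_eq0 => /eqP ->; left.
Qed.

Lemma cycle_kernel_dominated d X (c : R) :
    (forall i, c + 2 * a <= d i <= 1 - (c + 2 * a)) ->
  dominated c (cycle_kernel d X).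
Proof.
move=> hd i; have /andP [h1 h2] := hd i.
have -> : cycle_kernel d X i i = d i by rewrite mxE eqxx.
suff S : \sum_(j | j != i) `|cycle_kernel d X i j| <= 2 * a by lra.
apply: le_trans (_ : \sum_j (a *+ (j == s i) + a *+ (j == (s^-1)%g i)) <= _).
  rewrite [leLHS]big_mkcond; apply: ler_sum => j _.
  case: ifP => ji; last by rewrite addr_ge0 ?mulrn_wge0 // ltW.
  rewrite norm_cycle_kernel_off; last by rewrite eq_sym.
  rewrite /cycle_graph.
  have -> : (j == (s^-1)%g i) = (i == s j).
    by rewrite -(inj_eq (@perm_inj _ s)) permKV eq_sym.
  rewrite [i == j]eq_sym ji /=; case: (j == s i); case: (i == s j);
    rewrite /= ?mulr0n ?mulr1n ?mulr2n ?addr0 ?add0r ?lexx ?lerDl ?ltW //.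
have sum1 k : \sum_j a *+ (j == k) = a.
  by rewrite (bigD1 k) //= eqxx big1 ?addr0 // => j /negPf ->.
by rewrite big_split /= !sum1; lra.
Qed.

Lemma cycle_kernel_block_diag d X x : block_diag (porbit s x) (cycle_kernel d X).
Proof.
move=> i j ij; rewrite mxE; case: (eqVneq i j) ij => [->|_ ij]; first by rewrite eqxx.
case: (eqVneq j (s i)) ij => [->|_ ij]; first by rewrite mem_porbit_perm eqxx.
by case: (eqVneq i (s j)) ij => // ->; rewrite mem_porbit_perm eqxx.
Qed.

(** A row depends on the parameters of its own orbit only.  This is what makes
    perturbations of different orbits independent. *)
Lemma cycle_kernel_local d d' X X' i :
    (forall y, y \in porbit s i -> d y = d' y /\ (y \in X) = (y \in X')) ->
  forall j, cycle_kernel d X i j = cycle_kernel d' X' i j.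
Proof.
move=> loc j; rewrite !mxE; have [-> ->] := loc i (porbit_id _ _).
case: ifP => // _; case: ifP => // _; case: eqP => // ij.
by have [|_ ->] := loc j; rewrite // ij porbit_sym mem_porbit_perm porbit_id.
Qed.

Lemma cycle_kernel_flip d x i j : s x != x ->
  cycle_kernel d [set x] i j =
    (-1) ^+ ((i == x) && (j == s x) || (i == s x) && (j == x)) *
    cycle_kernel d finset.set0 i j.
Proof.
move=> sx; have sxV : (x == s x) = false by rewrite eq_sym (negPf sx).
have s2x : (x == s (s x)) = false by rewrite eq_sym (negPf (s2_neq sx)).
rewrite !mxE !inE; case: (eqVneq i j) => [<-|ij].
  case: (eqVneq i x) => [->|_]; first by rewrite sxV /= mul1r.
  by rewrite andbF mul1r.
case: (eqVneq j (s i)) => [->|jsi].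
  rewrite (inj_eq perm_inj) mulrA -signr_addb; congr ((-1) ^+ _ * _).
  rewrite addbF andbb; case: (eqVneq i x) => //= ix.
  by case: (eqVneq i (s x)) => //= ->; rewrite eq_sym s2x.
case: (eqVneq i (s j)) => [e|_]; last by rewrite mulr0.
rewrite mulrA -signr_addb addbF; congr ((-1) ^+ _ * _).
rewrite e (inj_eq perm_inj) andbb.
case: (eqVneq (s j) x) => //= sjx.
by case: (eqVneq j (s x)) => //= jsx; have := s2x; rewrite -jsx sjx eqxx.
Qed.

Lemma det_perturb_flip d x Y : s x != x ->
  `|block_det (porbit s x) (cycle_kernel d [set x]) Y -
    block_det (porbit s x) (cycle_kernel d finset.set0) Y|
  <= 4 * a ^+ #|porbit s x|.
Proof.
move=> sx; rewrite /block_det; set B := porbit s x.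
set K := cycle_kernel d finset.set0.
have moved y : y \in B -> s y != y by move=> yB; rewrite (porbit_moved yB).
have Moff i j : i \in B -> i != j ->
    `|mix_rows B (dpp_mx K Y) 1%:M i j| = a *+ cycle_graph s i j.
  move=> iB ij; rewrite -(norm_cycle_kernel_off d finset.set0 ij) -/K.
  rewrite mxE iB mxE; case: ifP => // _.
  by rewrite !mxE (negPf ij) add0r normrN.
apply: det_flip_cycle_edge.
- by move=> y yB; rewrite s2_neq ?moved.
- by move=> i iB j; rewrite mxE (negPf iB) mxE.
- move=> i j iB ji jsi sji; apply/eqP; rewrite -normr_eq0.
  rewrite Moff 1?[i == j]eq_sym // /cycle_graph (negPf jsi) [i == s j]eq_sym.
  by rewrite (negPf sji) andbF mulr0n.
- move=> i iB; have si := moved i iB.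
  rewrite !Moff ?mem_porbit_perm // 1?eq_sym //.
  by split; case: (cycle_graph s _ _); rewrite ?lexx // ltW.
move=> i j; rewrite mxE [in RHS]mxE; case: ifP => iB; last first.
  have -> : (i == x) = false by apply: contraFF iB => /eqP ->; apply: porbit_id.
  have -> : (i == s x) = false.
    by apply: contraFF iB => /eqP ->; rewrite mem_porbit_perm porbit_id.
  by rewrite mul1r.
rewrite mxE [in RHS]mxE; case: ifP => _; first exact: cycle_kernel_flip.
have subE (L : 'M[R]_N) : (1%:M - L) i j = (i == j)%:R - L i j by rewrite !mxE.
rewrite !subE cycle_kernel_flip // -/K; case: (eqVneq i j) => [<-|_].
  case: (eqVneq i x) => [->|_]; last by rewrite andbF !mul1r.
  by rewrite [x == _]eq_sym (negPf sx) !mul1r.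
by rewrite !add0r mulrN.
Qed.

(** By multilinearity in row [x], the difference is [e] or [- e] times a
    determinant whose rows have absolute sum at most 1. *)
Lemma det_perturb_diag d d' X x Y (e : R) :
    dominated 0 (cycle_kernel d X) ->
    (forall i, d' i = d i + (if i == x then e else 0)) ->
  `|block_det (porbit s x) (cycle_kernel d' X) Y -
    block_det (porbit s x) (cycle_kernel d X) Y| <= `|e|.
Proof.
rewrite /block_det; move=> Kdom d'E; set B := porbit s x; set K := cycle_kernel d X.
set K' := cycle_kernel d' X; set L := dpp_mx K Y.
pose C := mix_rows (B :\ x)%SET L 1%:M.
have K'E i j : K' i j = K i j + (if (i == x) && (j == x) then e else 0).
  rewrite !mxE d'E; case: (eqVneq i j) => [<-|ij]; first by rewrite andbb.
  case: (eqVneq i x) => [ix|]; last by rewrite addr0.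
  by rewrite -ix [j == i]eq_sym (negPf ij) addr0.
rewrite -/K in Kdom; clearbody K K'.
have xB : x \in B by apply: porbit_id.
pose f := if x \in Y then e else - e.
rewrite (@determinant_multilinear _ _ _ (mix_rows B L 1%:M) C x 1 f).
- rewrite mul1r addrAC subrr add0r normrM.
  have -> : `|f| = `|e| by rewrite /f; case: ifP; rewrite ?normrN.
  rewrite ler_piMr //; apply: le_trans (norm_det_le_prod_rows _) _.
  apply: prodr_ile1 => i _; rewrite sumr_ge0 //=; exact: norm_row_mix_rows_le1.
- apply/rowP => j; rewrite !(mxE, xB, eqxx, inE) /= !K'E eqxx /= /f.
  by case: ifP => _; rewrite [x == j]eq_sym; case: eqP => _ /=; ring.
- apply/matrixP => k j; rewrite mxE [RHS]mxE.
  have kx : (lift x k == x) = false by rewrite eq_sym (negPf (neq_lift x k)).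
  by rewrite !mxE !K'E kx /= !addr0.
- apply/matrixP => k j; rewrite mxE [RHS]mxE.
  have kx : (lift x k == x) = false by rewrite eq_sym (negPf (neq_lift x k)).
  by rewrite !(mxE, inE) kx /= !K'E kx /= !addr0.
Qed.
End CycleKernel.

(** * Separation for [rho], and the block permutation *)

Section SignDistance.
Variables (R : realType) (N : nat).
Implicit Types (K : 'M[R]_N) (w : 'I_N -> R).

Definition sign_fun w := forall i, w i = 1 \/ w i = -1.

Lemma sign_fun_sqr w i : sign_fun w -> w i * w i = 1.
Proof. by move=> hw; case: (hw i) => ->; rewrite ?mulr1 // mulrNN mulr1. Qed.

Lemma norm_sign_fun w i : sign_fun w -> `|w i| = 1.
Proof. by move=> hw; case: (hw i) => ->; rewrite ?normrN normr1. Qed.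

Lemma rho_lt K K' (e : R) : rho K K' < e ->
  exists2 w, sign_fun w & forall i j, `|w i * K i j * w j - K' i j| < e.
Proof.
move=> /inf_lt [|r [D [Ddiag D1] <-] De].
  exists (mx_norm (1%:M *m K *m 1%:M - K')); exists 1%:M => //; split.
    exact: scalar_mx_is_diag.
  by move=> i; left; rewrite mxE eqxx.
exists (fun i => D i i) => // i j.
have DE : D = diag_mx (\row_k D k k).
  apply/matrixP => p q; rewrite !mxE; case: eqVneq => [->//|pq].
  by move/is_diag_mxP: Ddiag => /(_ p q pq) ->.
have <- : (D *m K *m D - K') i j = D i i * K i j * D j j - K' i j.
  have dE (d : 'rV[R]_N) : (diag_mx d *m K *m diag_mx d - K') i j
      = d 0 i * K i j * d 0 j - K' i j by rewrite mul_diag_mx mul_mx_diag !mxE.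
  by rewrite {1 2}DE dE !mxE.
apply: le_lt_trans De; rewrite mx_normrE.
exact: (le_bigmax _ (fun ij : 'I_N * 'I_N => `|(D *m K *m D - K') ij.1 ij.2|) (i, j)).
Qed.

(** The triangle inequality for [rho]: the two sign functions that bring [K]
    close to [K1] and to [K2] are multiplied. *)
Lemma rho_lt2 K K1 K2 (e : R) : rho K K1 < e -> rho K K2 < e ->
  exists2 w, sign_fun w & forall i j, `|w i * K1 i j * w j - K2 i j| < 2 * e.
Proof.
move=> /rho_lt [u hu hu1] /rho_lt [v hv hv1].
exists (fun i => v i * u i) => [i|i j].
  by case: (hu i) => ->; case: (hv i) => ->; rewrite ?mulrN1 ?mulr1 ?opprK;
    [left|right|right|left].
have E : v i * u i * K1 i j * (v j * u j) - K2 i j =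
    - (v i * u i * (u i * K i j * u j - K1 i j) * (v j * u j))
    + (v i * K i j * v j - K2 i j).
  have := sign_fun_sqr i hu; have := sign_fun_sqr j hu => e1 e2.
  (* the squares u_i^2 = u_j^2 = 1 are inserted to make this an identity *)
  transitivity (v i * u i * K1 i j * (v j * u j)
     - v i * (u i * u i) * K i j * (u j * u j) * v j
     + v i * K i j * v j - K2 i j); last by ring.
  by rewrite e1 e2; ring.
rewrite E; apply: le_lt_trans (ler_normD _ _) _; rewrite normrN !normrM.
rewrite !norm_sign_fun // !mulr1 !mul1r.
by have := hu1 i j; have := hv1 i j; lra.
Qed.

End SignDistance.

Section BlockPermutation.
Variables (N l : nat).
Hypothesis l_gt2 : (2 < l)%N.

Let l_gt0 : (0 < l)%N. Proof. exact: leq_trans l_gt2. Qed.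

Let block_divK q r : ((q * l + r %% l) %/ l = q)%N.
Proof. by rewrite divnMDl // divn_small ?ltn_mod // addn0. Qed.

(** The successor of [i] in its block of length [l], cyclically; the last
    [N %% l] points, which do not fill a block, are fixed. *)
Definition block_next (i : nat) : nat :=
  if (i < N %/ l * l)%N then (i %/ l * l + (i %% l).+1 %% l)%N else i.

Lemma block_next_lt (i : 'I_N) : (block_next i < N)%N.
Proof.
rewrite /block_next; case: ifP => // h.
apply: leq_trans (leq_trunc_div N l).
by rewrite -ltn_divLR // block_divK ltn_divLR.
Qed.

Lemma block_next_in i : (block_next i < N %/ l * l)%N = (i < N %/ l * l)%N.
Proof.
rewrite /block_next; case: ifP => // h.
by rewrite -ltn_divLR // block_divK ltn_divLR.
Qed.

Definition block_step (i : 'I_N) : 'I_N := Ordinal (block_next_lt i).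

Lemma iter_block_step k (i : 'I_N) : (i < N %/ l * l)%N ->
  iter k block_step i = (i %/ l * l + (i %% l + k) %% l)%N :> nat.
Proof.
move=> hi; elim: k => [|k IH]; first by rewrite addn0 modn_mod -divn_eq.
have hk : (iter k block_step i < N %/ l * l)%N.
  by elim: (k) => //= m IHm; rewrite block_next_in.
rewrite iterS /= /block_next hk IH block_divK.
by rewrite modnMDl modn_mod -addn1 modnDml addn1 addnS.
Qed.

Lemma block_step_inj : injective block_step.
Proof.
move=> i j /(congr1 val) /= e; apply/val_inj => /=.
have := block_next_in i; have := block_next_in j; rewrite e => -> hij.
move: e; rewrite /block_next -hij; case: ifP => // hj e.
have q : (i %/ l = j %/ l)%N.
  by have := congr1 (divn^~ l) e; rewrite !block_divK.
move/eqP: e; rewrite q eqn_add2l -![(_ %% l).+1]add1n eqn_modDl !modn_mod => /eqP r.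
by rewrite (divn_eq i l) (divn_eq j l) q r.
Qed.

Definition block_perm : {perm 'I_N} := perm block_step_inj.

Lemma iter_block_perm k (i : 'I_N) : (i < N %/ l * l)%N ->
  iter k block_perm i = (i %/ l * l + (i %% l + k) %% l)%N :> nat.
Proof.
by move=> hi; rewrite -iter_block_step // (eq_iter (permE block_step_inj)).
Qed.

Lemma block_perm_in (i : 'I_N) : block_perm i != i -> (i < N %/ l * l)%N.
Proof.
apply: contraR => hi; apply/eqP/val_inj; rewrite permE /= /block_next.
by rewrite (negPf hi).
Qed.

Lemma card_porbit_block_perm (i : 'I_N) : (i < N %/ l * l)%N ->
  #|porbit block_perm i| = l.
Proof.
move=> hi; pose g (r : 'I_l) := iter r block_perm i.
have ginj : injective g.
  move=> r r' /(congr1 val) /eqP; rewrite /= !iter_block_perm // eqn_add2l eqn_modDl.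
  by rewrite !modn_small // => /eqP /val_inj.
have -> : porbit block_perm i = [set g r | r : 'I_l].
  apply/finset.setP => y; apply/idP/finset.imsetP =>
    [/porbit_iterP [k ->]|[r _ ->]]; last first.
    exact: mem_porbit_iter.
  exists (Ordinal (ltn_pmod k l_gt0)) => //; apply/val_inj.
  by rewrite /= !iter_block_perm //= modnDmr.
by rewrite card_imset // card_ord.
Qed.

Lemma block_base_lt (b : 'I_(N %/ l)) : (b * l < N)%N.
Proof. by apply: leq_trans (leq_trunc_div N l); rewrite ltn_mul2r l_gt0 ltn_ord. Qed.

Definition block_base (b : 'I_(N %/ l)) : 'I_N := Ordinal (block_base_lt b).

Lemma block_base_in b : (block_base b < N %/ l * l)%N.
Proof. by rewrite /= ltn_mul2r l_gt0 ltn_ord. Qed.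

Lemma block_base_moved b : block_perm (block_base b) != block_base b.
Proof.
apply/eqP => /(congr1 (@nat_of_ord N)); rewrite -[block_perm _]/(iter 1 block_perm _).
rewrite iter_block_perm ?block_base_in //= mulnK // modnMl add0n.
rewrite modn_small; last exact: ltnW.
by lia.
Qed.

Lemma block_base_sep b b' : b != b' ->
  block_base b' \notin porbit block_perm (block_base b).
Proof.
apply: contraNN => /porbit_iterP [k /(congr1 (fun i : 'I_N => (i %/ l)%N))].
rewrite iter_block_perm ?block_base_in //= !mulnK // block_divK => e.
by apply/eqP/val_inj.
Qed.

End BlockPermutation.

(** * Lower bounds for the two perturbed families *)

Definition hard_instance (R : realType) (N l n : nat) (a eps : R)
    (Khat : n.-tuple {set 'I_N} -> 'M[R]_N) : Prop :=
  exists (K : 'M[R]_N) (p : {set 'I_N} -> R),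
    [/\ is_kernel K,
        forall i j : 'I_N, (i < j)%N -> K i j = 0 \/ a <= `|K i j|,
        has_cycle_sparsity (induced_graph K) l,
        is_dpp K p
      & 1 / 3 <= iid_prob p (fun y => eps <= rho (Khat y) K)].

Section PerturbedFamily.
Variables (R : realType) (N l : nat) (s : {perm 'I_N}) (a : R).
Hypothesis l_ge3 : (3 <= l)%N.
Hypothesis card_orbit : forall x, s x != x -> #|porbit s x| = l.
Hypothesis a_gt0 : 0 < a.
Variables (I : finType) (base : I -> 'I_N).
Hypothesis I_gt0 : (0 < #|I|)%N.
Hypothesis base_moved : forall b, s (base b) != base b.
Hypothesis base_sep : forall b b', b != b' -> base b' \notin porbit s (base b).

Let s2_neq x : s x != x -> s (s x) != x.
Proof. by move=> sx; rewrite moved_twice // card_orbit. Qed.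

(** The argument common to both families.  [Kfam X] is the kernel perturbed at
    the points of [X]; besides the base kernel and the alternatives, only the
    kernels with two perturbed blocks matter, through [dpp_pmf_cross]. *)
Lemma family_lower_bound (Kfam : {set 'I_N} -> 'M[R]_N) (eps Delta : R) (n : nat)
    (Khat : n.-tuple {set 'I_N} -> 'M[R]_N) :
    (forall X, exists d F, Kfam X = cycle_kernel s a d F) ->
    (forall X, dominated 0 (Kfam X)) ->
    dominated (1 / 4) (Kfam finset.set0) ->
    (forall (X X' : {set 'I_N}) i,
       (forall y, y \in porbit s i -> (y \in X) = (y \in X')) ->
       forall j, Kfam X i j = Kfam X' i j) ->
    (forall b Y,
      `|block_det (porbit s (base b)) (Kfam [set base b]) Y -
        block_det (porbit s (base b)) (Kfam finset.set0) Y| <= Delta) ->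
    (forall b K, rho K (Kfam finset.set0) < eps ->
       rho K (Kfam [set base b]) < eps -> False) ->
    (1 + (Delta / (1 / 4) ^+ l) ^+ 2) ^+ n <= 1 + #|I|%:R / 3 ->
  hard_instance l a eps Khat.
Proof.
move=> Kfam_form Kfam_dom K0dom Kfam_loc Kfam_pert Kfam_sep small.
have Kfam_block X x : block_diag (porbit s x) (Kfam X).
  by have [d [F ->]] := Kfam_form X; apply: cycle_kernel_block_diag.
suff [X HX] : exists X, 1 / 3 <= iid_prob (dpp_pmf (Kfam X))
    (fun y : n.-tuple _ => eps <= rho (Khat y) (Kfam X)).
  exists (Kfam X), (dpp_pmf (Kfam X)); have [d [F E]] := Kfam_form X; split=> //.
  - apply: dominated_kernel => //; rewrite E; exact: cycle_kernel_sym.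
  - by move=> i j ij; rewrite E; apply: cycle_kernel_offdiag.
  - rewrite E induced_graph_cycle_kernel //; apply: cycle_graph_sparsity => //.
    by case/card_gt0P: I_gt0 => b _; exists (base b).
  - exact: is_dpp_pmf.
have base_orb b i : i \in porbit s (base b) -> porbit s i = porbit s (base b).
  by move=> h; apply/eqP; rewrite eq_porbit_mem.
have outb b i y : i \notin porbit s (base b) -> y \in porbit s i -> y != base b.
  by move=> h yi; apply: contraNneq h => <-; rewrite porbit_sym.
have p0_gt0 Y : 0 < dpp_pmf (Kfam finset.set0) Y.
  by apply: lt_le_trans (dpp_pmf_ge_exp Y _ K0dom); rewrite ?exprn_gt0; lra.
have cross b b' : b != b' -> \sum_Y dpp_pmf (Kfam [set base b]) Y *
    dpp_pmf (Kfam [set base b']) Y / dpp_pmf (Kfam finset.set0) Y = 1.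
  move=> bb'.
  rewrite -[RHS](sum_dpp_pmf (Kfam [set base b; base b'])); apply: eq_bigr => Y _.
  apply: (mulIf (lt0r_neq0 (p0_gt0 Y))); rewrite divfK ?gt_eqF // [RHS]mulrC.
  apply: (@dpp_pmf_cross _ _ (porbit s (base b))) => // i j ib; apply: Kfam_loc => y yi.
  - rewrite !inE; case: (eqVneq y (base b')) => [e|]; last by rewrite orbF.
    by move: (base_sep bb'); rewrite -e -(base_orb _ _ ib) yi.
  - by rewrite !inE (negPf (outb _ _ _ ib yi)).
  - rewrite !inE; apply/eqP => e.
    by move: (base_sep bb'); rewrite -e -(base_orb _ _ ib) yi.
  - by rewrite !inE (negPf (outb _ _ _ ib yi)).
have near b Y : `|dpp_pmf (Kfam [set base b]) Y - dpp_pmf (Kfam finset.set0) Y|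
    <= Delta / (1 / 4) ^+ l * dpp_pmf (Kfam finset.set0) Y.
  rewrite -(card_orbit (base_moved b)).
  have q0 : 0 < 1 / 4 :> R by lra.
  apply: (dpp_pmf_perturb q0) => //.
  move=> i j ib; apply: Kfam_loc => y yi.
  by rewrite !inE (negPf (outb _ _ _ ib yi)).
have fail b y : (eps <= rho (Khat y) (Kfam finset.set0)) ||
    (eps <= rho (Khat y) (Kfam [set base b])).
  rewrite !leNgt -negb_and; apply/negP => /andP [h1 h2].
  exact: Kfam_sep h1 h2.
case: (mixture_le_cam p0_gt0 (sum_dpp_pmf _) (fun b Y => dpp_pmf_ge0 Y (Kfam_dom _))
         (fun b => sum_dpp_pmf _) cross near I_gt0 small fail) => [h|[b h]].
  by exists finset.set0.
by exists [set base b].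
Qed.

Definition flip_kernel (X : {set 'I_N}) : 'M[R]_N :=
  cycle_kernel s a (fun=> 1 / 2) X.

Definition diag_kernel (eps : R) (X : {set 'I_N}) : 'M[R]_N :=
  cycle_kernel s a (fun i => 1 / 2 + (if i \in X then 2 * eps else 0)) finset.set0.

(** Entries in {a, - a} at distance below [2 * eps <= 2 * a] are equal, so the
    signs would turn the weights around the orbit of the base kernel into those
    of the alternative.  Taking the product around the orbit, every sign occurs
    twice, and 1 would be equal to -1. *)
Lemma flip_kernel_sep x (K : 'M[R]_N) (eps : R) : eps <= a -> s x != x ->
  rho K (flip_kernel finset.set0) < eps -> rho K (flip_kernel [set x]) < eps -> False.
Proof.
move=> epsa sx r0 r1; have [w hw hw2] := rho_lt2 r0 r1.
pose sg y : R := (-1) ^+ (y == x).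
have arcE y : y \in porbit s x -> w y * w (s y) = sg y.
  move=> yx; have sy : s y != y by rewrite (porbit_moved yx).
  have := hw2 y (s y); rewrite !mxE eq_sym (negPf sy) eqxx !inE expr0 mul1r -/(sg y).
  rewrite -mulrA [a * _]mulrC mulrA -mulrBl normrM (gtr0_norm a_gt0) => h.
  have {}h : `|w y * w (s y) - sg y| < 2.
    by rewrite -(ltr_pM2r a_gt0); apply: lt_le_trans h _; lra.
  move: h; rewrite /sg; case: (hw y) => ->; case: (hw (s y)) => ->; case: (y == x);
    rewrite ?expr0 ?expr1 ltr_norml => /andP []; lra.
have : \prod_(y in porbit s x) (w y * w (s y)) = -1.
  rewrite (eq_bigr sg) // (bigD1 x) ?porbit_id //= /sg eqxx expr1 big1 ?mulr1 //.
  by move=> y /andP [_ /negPf ->].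
rewrite big_split /=.
have -> : \prod_(y in porbit s x) w (s y) = \prod_(y in porbit s x) w y.
  rewrite [RHS](reindex_inj (@perm_inj _ s)) /=.
  by apply: eq_bigl => y; rewrite mem_porbit_perm.
have := sqr_ge0 (\prod_(y in porbit s x) w y); rewrite expr2; lra.
Qed.

(** Conjugation by signs fixes the diagonal, where the kernels differ by
    [2 * eps]. *)
Lemma diag_kernel_sep x (K : 'M[R]_N) (eps : R) : 0 < eps ->
  rho K (diag_kernel eps finset.set0) < eps -> rho K (diag_kernel eps [set x]) < eps ->
  False.
Proof.
move=> eps0 r0 r1; have [w hw hw2] := rho_lt2 r0 r1.
have := hw2 x x; rewrite !mxE !inE !eqxx mulrAC (sign_fun_sqr _ hw) mul1r.
by rewrite ltr_norml => /andP []; lra.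
Qed.

Variables (eps : R) (n : nat) (Khat : n.-tuple {set 'I_N} -> 'M[R]_N).
Hypotheses (eps_gt0 : 0 < eps) (eps_le : eps <= a) (a_le : a <= 1 / 8).

Lemma flip_lower_bound :
  (1 + (4 * a ^+ l / (1 / 4) ^+ l) ^+ 2) ^+ n <= 1 + #|I|%:R / 3 ->
  hard_instance l a eps Khat.
Proof.
apply: (@family_lower_bound flip_kernel).
- by move=> X; exists (fun=> 1 / 2), X.
- by move=> X; apply: cycle_kernel_dominated => // _; apply/andP; split=> /=;
    move: a_gt0 a_le eps_gt0 eps_le; lra.
- by apply: cycle_kernel_dominated => // _; apply/andP; split=> /=;
    move: a_gt0 a_le eps_gt0 eps_le; lra.
- by move=> X X' i loc j; apply: cycle_kernel_local => y /loc.
- move=> b Y; rewrite -(card_orbit (base_moved b)); exact: det_perturb_flip.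
- by move=> b K; apply: flip_kernel_sep.
Qed.

Lemma diag_lower_bound :
  (1 + (2 * eps / (1 / 4) ^+ l) ^+ 2) ^+ n <= 1 + #|I|%:R / 3 ->
  hard_instance l a eps Khat.
Proof.
apply: (@family_lower_bound (diag_kernel eps)).
- by move=> X; eexists; eexists.
- by move=> X; apply: cycle_kernel_dominated => // i; apply/andP; case: ifP => _; split=> /=;
    move: a_gt0 a_le eps_gt0 eps_le; lra.
- by apply: cycle_kernel_dominated => // i; rewrite inE; apply/andP; split=> /=;
    move: a_gt0 a_le eps_gt0 eps_le; lra.
- by move=> X X' i loc j; apply: cycle_kernel_local => y /loc ->.
- move=> b Y; rewrite -[leRHS]gtr0_norm ?mulr_gt0 //.
  apply: det_perturb_diag => //.
    by apply: cycle_kernel_dominated => // i; rewrite inE; apply/andP; split=> /=;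
    move: a_gt0 a_le eps_gt0 eps_le; lra.
  by move=> i; rewrite !inE addr0.
- by move=> b K; apply: diag_kernel_sep.
Qed.

End PerturbedFamily.

(** * The final bookkeeping *)

Section Numeric.
Variable R : realType.

Lemma exprn_1D_le (x y : R) (n : nat) : 0 < y -> 0 <= x -> n%:R * x <= ln y ->
  (1 + x) ^+ n <= y.
Proof.
move=> y0 x0 h; rewrite -[leRHS]lnK //; apply: le_trans (_ : expR (n%:R * x) <= _).
  by rewrite expRM_natl lerXn2r ?nnegrE ?addr_ge0 ?expR_ge0 ?expR_ge1Dx.
by rewrite ler_expR.
Qed.

(** With [m = N %/ l] one has [N < (m + 1) * l], and [m + 1 <= (1 + m / 3) ^+ 3]
    by Bernoulli's inequality; [ln l] is absorbed through
    [ln (4 / 3) <= ln (1 + m / 3)], as [m] is at least 1. *)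
Lemma ln_dim_le (N l : nat) : (0 < l)%N -> (l <= N)%N ->
  ln N%:R <= (3 + ln l%:R / ln (4 / 3)) * ln (1 + (N %/ l)%:R / 3) :> R.
Proof.
move=> l0 lN; set m := (N %/ l)%N; set t : R := m%:R / 3.
have m1 : (1 <= m)%N by rewrite divn_gt0.
have t1 : 1 / 3 <= t by rewrite ler_pM2r ?invr_gt0 // ler1n.
have c0 : 0 < ln (4 / 3 : R) by rewrite ln_gt0 //; lra.
have cl : ln (4 / 3) <= ln (1 + t) by rewrite ler_ln ?posrE; lra.
have t0 : 0 < 1 + t by lra.
have N0 : 0 < N%:R :> R by rewrite ltr0n (leq_trans l0).
have ll : 0 <= ln (l%:R : R) by rewrite ln_ge0 // ler1n.
apply: le_trans (_ : ln ((1 + t) ^+ 3 * l%:R) <= _).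
  have t30 : 0 < (1 + t) ^+ 3 by rewrite exprn_gt0 //; lra.
  have l0R : 0 < l%:R :> R by rewrite ltr0n.
  rewrite ler_ln ?posrE ?mulr_gt0 //.
  apply: le_trans (_ : (m.+1)%:R * l%:R <= _).
    by rewrite -natrM ler_nat ltnW // ltn_ceil.
  rewrite ler_pM2r ?ltr0n // -natr1.
  have -> : m%:R = 3 * t by rewrite /t; field.
  nra.
rewrite lnM ?posrE ?exprn_gt0 ?ltr0n // lnXn //.
rewrite mulrDl -[X in X + _]mulr_natl lerD2l mulrAC ler_pdivlMr // ler_wpM2l //.
Qed.

End Numeric.

Theorem theorem2 (R : realType) (l : nat) (hl : (3 <= l)%N) :
  exists2 C : R, 0 < C &
    forall (N : nat) (alpha eps : R),
      (l <= N)%N -> 0 < eps -> eps <= alpha -> alpha <= 1 / 8 ->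
    forall n : nat,
      n%:R <= C * (8 ^+ l / alpha ^+ (2 * l)
                   + ln (N%:R / l%:R) / (6 * alpha) ^+ l
                   + ln N%:R / eps ^+ 2) ->
    forall Khat : n.-tuple {set 'I_N} -> 'M[R]_N,
    exists (K : 'M[R]_N) (p : {set 'I_N} -> R),
      [/\ is_kernel K,
          forall i j : 'I_N, (i < j)%N -> K i j = 0 \/ alpha <= `|K i j|,
          has_cycle_sparsity (induced_graph K) l,
          is_dpp K p
        & 1 / 3 <= iid_prob p (fun y => eps <= rho (Khat y) K)].
Proof.
have l0 : (0 < l)%N by apply: leq_trans hl.
have l0R : 0 < l%:R :> R by rewrite ltr0n.
have c0 : 0 < ln (4 / 3 : R) by rewrite ln_gt0 //; lra.
have ll : 0 <= ln (l%:R : R) by rewrite ln_ge0 // ler1n.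
(* [A1] and [A2] convert [8 ^+ l] and [ln N] into multiples of
   [ln (1 + m / 3)], which is at least [ln (4 / 3)] *)
pose A1 : R := 8 ^+ l / ln (4 / 3); pose A2 : R := 3 + ln l%:R / ln (4 / 3).
have A1_gt0 : 0 < A1 by rewrite divr_gt0 ?exprn_gt0.
have A2_gt0 : 0 < A2 by rewrite ltr_pwDl ?divr_ge0 // ltW.
pose q : R := (1 / 4) ^- l.
have q4 : 0 < 1 / 4 :> R by lra.
have q0 : 0 < q by rewrite invr_gt0 exprn_gt0.
pose A := A1 + A2 + A2; have A_gt0 : 0 < A.
  exact: addr_gt0 (addr_gt0 A1_gt0 A2_gt0) A2_gt0.
have B0 : 0 < 16 * q ^+ 2 * A by rewrite !mulr_gt0 ?exprn_gt0.
exists (16 * q ^+ 2 * A)^-1; first by rewrite invr_gt0.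
move=> N alpha eps lN eps0 epsa a8 n hn Khat.
have a0 : 0 < alpha by apply: lt_le_trans epsa.
have m1 : (1 <= N %/ l)%N by rewrite divn_gt0.
pose m : R := (N %/ l)%:R; have m0 : 1 <= m by rewrite ler1n.
pose lam := ln (1 + m / 3).
have m4 : 4 / 3 <= 1 + m / 3 by lra.
have mp : 0 < 1 + m / 3 by lra.
have lam_ge : ln (4 / 3) <= lam by rewrite ler_ln ?posrE //; lra.
have lam0 : 0 < lam by apply: lt_le_trans lam_ge.
have N0 : 0 < N%:R :> R by rewrite ltr0n (leq_trans l0).
have lnN : ln N%:R <= A2 * lam by apply: ln_dim_le.
pose u := alpha ^+ (2 * l); pose v := eps ^+ 2.
have u0 : 0 < u by apply: exprn_gt0.
have v0 : 0 < v by apply: exprn_gt0.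
have T1 : 8 ^+ l / u <= A1 * lam / u.
  rewrite ler_pM2r ?invr_gt0 // /A1 mulrAC ler_pdivlMr //.
  by rewrite ler_wpM2l // exprn_ge0.
have T2 : ln (N%:R / l%:R) / (6 * alpha) ^+ l <= A2 * lam / u.
  have a6 : 0 < 6 * alpha by rewrite mulr_gt0.
  apply: ler_pM.
  - by rewrite ln_ge0 // ler_pdivlMr // mul1r ler_nat.
  - by rewrite invr_ge0 exprn_ge0 // ltW.
  - apply: le_trans lnN; rewrite ler_ln ?posrE ?divr_gt0 //.
    by rewrite ler_pdivrMr // ler_peMr ?ler1n // ltW.
  rewrite lef_pV2 ?posrE ?exprn_gt0 // /u exprM lerXn2r ?nnegrE ?exprn_ge0 ?ltW //.
  by rewrite expr2; nra.
have T3 : ln N%:R / v <= A2 * lam / v by rewrite ler_pM2r ?invr_gt0.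
have moved := @block_base_moved N l hl; have sep := @block_base_sep N l hl.
have card_I : (0 < #|'I_(N %/ l)|)%N by rewrite card_ord.
have orb x : block_perm N hl x != x -> #|porbit (block_perm N hl) x| = l.
  by move=> /block_perm_in hx; apply: card_porbit_block_perm.
(* [w] will be the smaller of [u] and [v]; all three terms are then at most
   multiples of [lam / w] *)
have budget w : 0 < w -> w <= u -> w <= v -> n%:R * (16 * q ^+ 2 * w) <= lam.
  move=> w0 wu wv.
  have lw x : 0 < x -> w <= x -> x^-1 <= w^-1 by move=> x0 wx; rewrite lef_pV2 ?posrE.
  have B : 8 ^+ l / u + ln (N%:R / l%:R) / (6 * alpha) ^+ l + ln N%:R / v <= A * lam / w.
    have -> : A * lam / w = A1 * lam / w + A2 * lam / w + A2 * lam / w.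
      by rewrite /A; clearbody A1 A2; ring.
    apply: lerD; first apply: lerD.
    - by apply: le_trans T1 _; rewrite ler_wpM2l ?lw // mulr_ge0 // ltW.
    - by apply: le_trans T2 _; rewrite ler_wpM2l ?lw // mulr_ge0 // ltW.
    - by apply: le_trans T3 _; rewrite ler_wpM2l ?lw // mulr_ge0 // ltW.
  have C0 : 0 <= (16 * q ^+ 2 * A)^-1 by rewrite invr_ge0 ltW.
  have := le_trans hn (ler_wpM2l C0 B).
  have W0 : 0 < 16 * q ^+ 2 * w by rewrite !mulr_gt0 ?exprn_gt0.
  rewrite -(ler_pM2r W0) => h; apply: le_trans h _.
  by rewrite le_eqVlt; apply/orP; left; apply/eqP; field; rewrite !gt_eqF.
have [uv|vu] := lerP u v.
  apply: (@flip_lower_bound R N l (block_perm N hl) alpha hl orb a0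
            'I_(N %/ l) (block_base hl) card_I moved sep eps n Khat) => //.
  rewrite card_ord -/m; apply: exprn_1D_le => //; first exact: sqr_ge0.
  have -> : (4 * alpha ^+ l / (1 / 4) ^+ l) ^+ 2 = 16 * q ^+ 2 * u.
    by rewrite /u /q mulnC exprM; ring.
  exact: budget.
apply: (@diag_lower_bound R N l (block_perm N hl) alpha hl orb a0
          'I_(N %/ l) (block_base hl) card_I moved sep eps n Khat) => //.
rewrite card_ord -/m; apply: exprn_1D_le => //; first exact: sqr_ge0.
apply: le_trans (budget v v0 (ltW vu) (lexx _)).
rewrite ler_wpM2l //.
have -> : (2 * eps / (1 / 4) ^+ l) ^+ 2 = 4 * (q ^+ 2 * v) by rewrite /v /q; ring.
rewrite -mulrA ler_wpM2r ?mulr_ge0 ?exprn_ge0 ?ltW //; lra.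
Qed.
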